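(* (1) The Jordan algebra $\mathcal{J}^3_1$ has no embedding into $\mathbb{S}^4$. (2) The Jordan algebra $\mathbb{C}\times\mathcal{J}^2_0$ has no embedding into $\mathbb{S}^4$. (3) Every embedding of $\mathcal{E}_1$ into $\mathbb{S}^4$ is congruent to one of $$E^{(1)}_{4,1}:=\begin{pmatrix}v&w&x&0\\ w&y&0&0\\ x&0&0&0\\0&0&0&x\end{pmatrix},\qquad E^{(1)}_{4,2}:=\begin{pmatrix}v&w&x&0\\ w&y&0&0\\ x&0&0&0\\0&0&0&y\end{pmatrix}.$$ (4) Every embedding of $\mathcal{E}_2$ into $\mathbb{S}^4$ is congruent to $$E^{(2)}_4:=\begin{pmatrix}v&x&w&0\\ x&0&0&0\\ w&0&0&y\\0&0&y&0\end{pmatrix}.$$ (5) Every embedding of $\mathcal{E}_3$ into $\mathbb{S}^4$ is congruent to $$E^{(3)}_4:=\begin{pmatrix}y&x&u&z\\ x&u&0&0\\ u&0&0&0\\ z&0&0&u\end{pmatrix}.$$ (6) The Jordan algebra $\mathcal{E}_4$ has no embeddings into $\mathbb{S}^4$. (7) Every embedding of $\mathcal{J}^3_0$ into $\mathbb{S}^4$ is congruent to $$F_4:=\begin{pmatrix}x&y&0&u\\ y&z&u&0\\0&u&0&0\\ u&0&0&0\end{pmatrix}.$$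
   Context: $\mathbb{S}^n$ is the space of complex symmetric $n\times n$ matrices. A (unital) Jordan algebra is a complex vector space with a symmetric bilinear product satisfying $(x\cdot x)\cdot(x\cdot y)=x\cdot((x\cdot x)\cdot y)$ for all $x,y$ and having a unit; morphisms are linear maps preserving products and units. For an invertible $U\in\mathbb{S}^n$, the product $X\bullet_U Y=\frac12(XU^{-1}Y+YU^{-1}X)$ makes $\mathbb{S}^n$ a unital Jordan algebra with unit $U$. An embedding of a Jordan algebra $\mathcal{A}$ into $\mathbb{S}^n$ is the image of an injective morphism of unital Jordan algebras $\mathcal{A}\to(\mathbb{S}^n,\bullet_U)$ for some invertible $U\in\mathbb{S}^n$. Two subspaces $\mathcal{L},\mathcal{L}'\subseteq\mathbb{S}^n$ are congruent if $\mathcal{L}'=P\mathcal{L}P^\top$ for some $P\in\mathrm{GL}_n(\mathbb{C})$. For integers $d\ge1$, $0\le r\le d$, $\mathcal{J}^d_r$ is the Jordan algebra $\mathbb{C}\times\mathbb{C}^d$ with product $(\lambda,v)\cdot(\mu,w)=(\lambda\mu+\beta(v,w),\lambda w+\mu v)$, where $\beta(v,w)=v_1w_1+\dots+v_rw_r$. Products of Jordan algebras carry the componentwise product. The $4$-dimensional Jordan algebras $\mathcal{E}_i$ are given by the following (commutative) multiplication tables. - $\mathcal{E}_1$: basis $X,Y,V,W$ with unit $X+Y$ and $X^2=X$, $XY=0$, $XV=V$, $XW=\frac12W$, $Y^2=Y$, $YV=0$, $YW=\frac12W$, $V^2=0$, $VW=0$, $W^2=V$. - $\mathcal{E}_2$: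 the same table as $\mathcal{E}_1$ except that $W^2=0$. - $\mathcal{E}_3$: basis $U,X,Y,Z$ with unit $U$, $X^2=Y$, $Z^2=Y$, and $XY=XZ=Y^2=YZ=0$. - $\mathcal{E}_4=\mathbb{C}[x,y]/(x^3,xy,y^2)$: basis $U,X,Y,Z$ with unit $U$, $X^2=Y$, and $XY=XZ=Y^2=YZ=Z^2=0$. A matrix whose entries are linear forms in indeterminates ($u,v,w,x,y,z$) denotes the linear space of all matrices obtained by substituting complex numbers for the indeterminates. *)

(* Defs.v *)
From HB Require Import structures.
From mathcomp Require Import all_boot all_order all_algebra.
From mathcomp Require Import ring.
From mathcomp Require Export classical_sets reals complex.

Set Implicit Arguments.
Unset Strict Implicit.
Unset Printing Implicit Defensive.

Import GRing.Theory Num.Theory.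
Local Open Scope ring_scope.
Local Open Scope classical_set_scope.

(* Unital Jordan algebras; linearity of the product in its first argument
   follows from jmul_linear and jmulC. *)
Record jordanAlg (F : numFieldType) := JordanAlg {
  jsort :> lmodType F;
  jmul : jsort -> jsort -> jsort;
  junit : jsort;
  jmul_linear : forall x, linear (jmul x);
  jmulC : commutative jmul;
  jmul_jordan : forall x y,
    jmul (jmul x x) (jmul x y) = jmul x (jmul (jmul x x) y);
  jmul1 : left_id junit jmul
}.

Definition jordan_morphism (F : numFieldType) (A B : jordanAlg F)
    (f : {linear A -> B}) : Prop :=
  (forall x y, f (jmul x y) = jmul (f x) (f y)) /\ f (junit A) = junit B.

Section SymmetricMatrices.
Variables (F : numFieldType) (n : nat).

Definition symmx : pred 'M[F]_n := fun A => A^T == A.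

Fact symmx_submod_closed : submod_closed symmx.
Proof.
split=> [|a A B]; first by rewrite unfold_in /symmx trmx0.
rewrite !unfold_in /symmx => /eqP hA /eqP hB.
by rewrite linearD linearZ /= hA hB.
Qed.

HB.instance Definition _ :=
  GRing.isSubmodClosed.Build F 'M[F]_n symmx symmx_submod_closed.

Record sym_matrix := SymMatrix {
  sym_val :> 'M[F]_n;
  sym_valP : sym_val \in symmx
}.

HB.instance Definition _ := [isSub for sym_val].
HB.instance Definition _ := [Choice of sym_matrix by <:].
HB.instance Definition _ := [SubChoice_isSubLmodule of sym_matrix by <:].

Lemma sym_trmx (A : sym_matrix) : (A : 'M_n)^T = A.
Proof. exact/eqP/(sym_valP A). Qed.

Variable U : sym_matrix.

Fact sym_mul_subproof (A B : sym_matrix) :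
  2^-1 *: (A *m invmx U *m B + B *m invmx U *m A) \in symmx.
Proof.
rewrite unfold_in /symmx linearZ linearD /= !trmx_mul trmx_inv !sym_trmx.
by rewrite !mulmxA addrC.
Qed.

Definition sym_mul (A B : sym_matrix) : sym_matrix :=
  SymMatrix (sym_mul_subproof A B).

Hypothesis U_unit : (U : 'M_n) \in unitmx.

Fact sym_mul_linear A : linear (sym_mul A).
Proof.
move=> a B C; apply: val_inj => /=.
rewrite mulmxDr mulmxDl mulmxDl -!scalemxAr -!scalemxAl addrACA -scalerDr.
by rewrite [LHS]scalerDr !scalerA mulrC.
Qed.

Fact sym_mulC : commutative sym_mul.
Proof. by move=> A B; apply: val_inj => /=; rewrite addrC. Qed.

Fact sym_mul_jordan A B :
  sym_mul (sym_mul A A) (sym_mul A B) = sym_mul A (sym_mul (sym_mul A A) B).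
Proof.
apply: val_inj => /=; set V := invmx U; set a := sym_val A; set b := sym_val B.
have -> : 2^-1 *: (a *m V *m a + a *m V *m a) = a *m V *m a.
  by rewrite -mulr2n -scaler_nat scalerA mulVf ?pnatr_eq0 // scale1r.
rewrite -!scalemxAr -!scalemxAl -!scalerDr; congr (_ *: (_ *: _)).
rewrite !(mulmxDl, mulmxDr) !mulmxA.
by rewrite addrACA.
Qed.

Fact sym_mul1 : left_id U sym_mul.
Proof.
move=> A; apply: val_inj => /=.
rewrite mulmxV // mul1mx mulmxKV // -mulr2n -scaler_nat scalerA.
by rewrite mulVf ?pnatr_eq0 // scale1r.
Qed.

(* The space of symmetric matrices with the product
   (A U^-1 B + B U^-1 A) / 2 and unit U. *)
Definition Sym : jordanAlg F :=
  JordanAlg sym_mul_linear sym_mulC sym_mul_jordan sym_mul1.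

End SymmetricMatrices.

Definition is_embedding (F : numFieldType) (A : jordanAlg F) (n : nat)
    (L : set 'M[F]_n) : Prop :=
  exists (U : sym_matrix F n) (U_unit : (U : 'M_n) \in unitmx)
         (f : {linear A -> Sym U_unit}),
    [/\ jordan_morphism f, injective f & L = range (fun a => sym_val (f a))].

Definition congruent (F : numFieldType) (n : nat) (L L' : set 'M[F]_n) : Prop :=
  exists2 P : 'M[F]_n,
    P \in unitmx & L' = [set P *m A *m P^T | A in L].

Section FieldAlgebra.
Variable F : numFieldType.

Fact field_mul_linear (x : F^o) : linear ( *%R x : F^o -> F^o).
Proof. by move=> a y z; rewrite mulrDr -scalerAr. Qed.

Fact field_mul_jordan (x y : F^o) : x * x * (x * y) = x * (x * x * y).
Proof. by rewrite !mulrA. Qed.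

Definition field_jordan : jordanAlg F :=
  @JordanAlg F F^o *%R 1 field_mul_linear (@mulrC F) field_mul_jordan
    (@mul1r F).

End FieldAlgebra.

Section ProductAlgebra.
Variables (F : numFieldType) (A B : jordanAlg F).

Definition prod_mul (x y : A * B) : A * B := (jmul x.1 y.1, jmul x.2 y.2).

Fact prod_mul_linear x : linear (prod_mul x).
Proof.
by move=> a y z; congr pair; rewrite jmul_linear.
Qed.

Fact prod_mulC : commutative prod_mul.
Proof. by move=> x y; congr pair; apply: jmulC. Qed.

Fact prod_mul_jordan x y :
  prod_mul (prod_mul x x) (prod_mul x y) =
  prod_mul x (prod_mul (prod_mul x x) y).
Proof. by congr pair; apply: jmul_jordan. Qed.

Fact prod_mul1 : left_id (junit A, junit B) prod_mul.
Proof. by case=> x y; congr pair; apply: jmul1. Qed.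

Definition prod_jordan : jordanAlg F :=
  JordanAlg prod_mul_linear prod_mulC prod_mul_jordan prod_mul1.

End ProductAlgebra.

Section BilinearFormAlgebra.
Variables (F : numFieldType) (d r : nat).

Definition spin_form (v w : 'rV[F]_d) : F :=
  \sum_(i < d | (i < r)%N) v 0 i * w 0 i.

Definition spin_mul (x y : F^o * 'rV[F]_d) : F^o * 'rV[F]_d :=
  (x.1 * y.1 + spin_form x.2 y.2, x.1 *: y.2 + y.1 *: x.2).

Fact spin_formC v w : spin_form v w = spin_form w v.
Proof. by apply: eq_bigr => i _; rewrite mulrC. Qed.

Fact spin_form_linear v : linear (spin_form v : _ -> F^o).
Proof.
move=> a y z; rewrite /spin_form scaler_sumr -big_split; apply: eq_bigr => i _.
by rewrite !mxE mulrDr /= [_ *: _]mulrCA.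
Qed.

Fact spin_mul_linear x : linear (spin_mul x).
Proof.
move=> a [l v] [m w]; rewrite /spin_mul /=; congr pair => /=.
  rewrite spin_form_linear /= !/(_ *: _) /=; ring.
by rewrite scalerDr scalerDl scalerDr !scalerA mulrC addrACA.
Qed.

Fact spin_mulC : commutative spin_mul.
Proof.
by move=> x y; congr pair; [rewrite mulrC spin_formC | rewrite addrC].
Qed.

Fact spin_mul_jordan x y :
  spin_mul (spin_mul x x) (spin_mul x y) =
  spin_mul x (spin_mul (spin_mul x x) y).
Proof.
case: x y => [l v] [m w]; rewrite /spin_mul /=.
have bD u p q : spin_form u (p + q) = spin_form u p + spin_form u q.
  by have := spin_form_linear u 1 p q; rewrite !scale1r.
have bZ u a p : spin_form u (a *: p) = a * spin_form u p.
  by have := spin_form_linear u a p 0; rewrite !addr0 [spin_form u 0]big1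
    ?addr0 // => i _; rewrite mxE mulr0.
rewrite !(bD, bZ) ![spin_form (_ + _) _]spin_formC !(bD, bZ).
rewrite [spin_form w v]spin_formC.
by congr pair; last (apply/rowP => i; rewrite !mxE); ring.
Qed.

Fact spin_mul1 : left_id (1, 0) spin_mul.
Proof.
move=> [l v]; rewrite /spin_mul /= mul1r scale1r scaler0 addr0; congr pair.
by rewrite /spin_form big1 ?addr0 // => i _; rewrite mxE mul0r.
Qed.

(* Meaningful for r <= d. *)
Definition J : jordanAlg F :=
  JordanAlg spin_mul_linear spin_mulC spin_mul_jordan spin_mul1.

End BilinearFormAlgebra.

Section TableAlgebras.
Variable F : numFieldType.

(* The bilinear product on F^4 whose value on the i-th and j-th basis vectors
   is the entry (i, j) of the table T. *)
Definition table_mul (T : seq (seq 'rV[F]_4)) (x y : 'rV[F]_4) : 'rV[F]_4 :=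
  \sum_(i < 4) \sum_(j < 4) (x 0 i * y 0 j) *: (nth [::] T i)`_j.

Fact table_mul_linear T x : linear (table_mul T x).
Proof.
move=> a y z; rewrite /table_mul scaler_sumr -big_split; apply: eq_bigr => i _.
rewrite scaler_sumr -big_split; apply: eq_bigr => j _ /=.
by rewrite !mxE mulrDr scalerDl scalerA mulrCA.
Qed.

Definition basis4 (k : nat) : 'rV[F]_4 := delta_mx 0 (inord k).

Local Notation b := basis4.
Local Notation h := (2^-1).

(* Basis X, Y, V, W. *)
Definition E1_table :=
  let X := b 0 in let Y := b 1 in let V := b 2 in let W := b 3 in
  [:: [:: X;      0;      V; h *: W];
      [:: 0;      Y;      0; h *: W];
      [:: V;      0;      0; 0];
      [:: h *: W; h *: W; 0; V]].

Definition E2_table :=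
  let X := b 0 in let Y := b 1 in let V := b 2 in let W := b 3 in
  [:: [:: X;      0;      V; h *: W];
      [:: 0;      Y;      0; h *: W];
      [:: V;      0;      0; 0];
      [:: h *: W; h *: W; 0; 0]].

(* Basis U, X, Y, Z. *)
Definition E3_table :=
  let U := b 0 in let X := b 1 in let Y := b 2 in let Z := b 3 in
  [:: [:: U; X; Y; Z];
      [:: X; Y; 0; 0];
      [:: Y; 0; 0; 0];
      [:: Z; 0; 0; Y]].

Definition E4_table :=
  let U := b 0 in let X := b 1 in let Y := b 2 in let Z := b 3 in
  [:: [:: U; X; Y; Z];
      [:: X; Y; 0; 0];
      [:: Y; 0; 0; 0];
      [:: Z; 0; 0; 0]].

Definition row4 (s : seq F) : 'rV[F]_4 := \row_(i < 4) s`_i.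

Fact table_coord T (x y : 'rV[F]_4) (k : 'I_4) :
  table_mul T x y 0 k =
  \sum_(i < 4) \sum_(j < 4) x 0 i * y 0 j * (nth [::] T i)`_j 0 k.
Proof.
rewrite summxE; apply: eq_bigr => i _; rewrite summxE; apply: eq_bigr => j _.
by rewrite mxE.
Qed.

Definition coord4 (x : 'rV[F]_4) (k : nat) := x 0 (inord k).

Local Notation c := coord4.

Lemma row4E x : x = row4 [:: c x 0; c x 1; c x 2; c x 3].
Proof.
apply/rowP => -[[|[|[|[|//]]]] lt_k]; rewrite mxE /coord4 /=; congr (x _ _);
  by apply: val_inj; rewrite /= inordK.
Qed.

Lemma c_row4 s k : (k < 4)%N -> c (row4 s) k = s`_k.
Proof. by move=> lt_k; rewrite /coord4 mxE inordK. Qed.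

Local Ltac coords x y :=
  rewrite {1}[x]row4E {1}[y]row4E; apply/rowP => -[[|[|[|[|//]]]] lt_k];
  rewrite table_coord !(big_ord_recl, big_ord0) /= !mxE /= -!val_eqE /=
    !inordK //=; ring.

Lemma E1_mulE x y : table_mul E1_table x y =
  row4 [:: c x 0 * c y 0; c x 1 * c y 1;
           c x 0 * c y 2 + c x 2 * c y 0 + c x 3 * c y 3;
           h * (c x 0 * c y 3 + c x 3 * c y 0 + c x 1 * c y 3 + c x 3 * c y 1)].
Proof. coords x y. Qed.

Lemma E2_mulE x y : table_mul E2_table x y =
  row4 [:: c x 0 * c y 0; c x 1 * c y 1; c x 0 * c y 2 + c x 2 * c y 0;
           h * (c x 0 * c y 3 + c x 3 * c y 0 + c x 1 * c y 3 + c x 3 * c y 1)].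
Proof. coords x y. Qed.

Lemma E3_mulE x y : table_mul E3_table x y =
  row4 [:: c x 0 * c y 0; c x 0 * c y 1 + c x 1 * c y 0;
           c x 0 * c y 2 + c x 2 * c y 0 + c x 1 * c y 1 + c x 3 * c y 3;
           c x 0 * c y 3 + c x 3 * c y 0].
Proof. coords x y. Qed.

Lemma E4_mulE x y : table_mul E4_table x y =
  row4 [:: c x 0 * c y 0; c x 0 * c y 1 + c x 1 * c y 0;
           c x 0 * c y 2 + c x 2 * c y 0 + c x 1 * c y 1;
           c x 0 * c y 3 + c x 3 * c y 0].
Proof. coords x y. Qed.

Lemma c_b k l : (l < 4)%N -> (k < 4)%N -> c (b k) l = (l == k)%:R.
Proof. by move=> lt_l lt_k; rewrite /coord4 /basis4 mxE /= -val_eqE /= !inordK. Qed.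

Lemma cD x y k : c (x + y) k = c x k + c y k.
Proof. by rewrite /coord4 mxE. Qed.

Local Ltac by_coords E :=
  rewrite !E ?cD ?c_row4 //= ?c_b //=; try (congr (row4 [:: _; _; _; _]));
  field; rewrite ?pnatr_eq0 //.

Fact E1_mulC : commutative (table_mul E1_table).
Proof. move=> x y; by_coords E1_mulE. Qed.
Fact E2_mulC : commutative (table_mul E2_table).
Proof. move=> x y; by_coords E2_mulE. Qed.
Fact E3_mulC : commutative (table_mul E3_table).
Proof. move=> x y; by_coords E3_mulE. Qed.
Fact E4_mulC : commutative (table_mul E4_table).
Proof. move=> x y; by_coords E4_mulE. Qed.

Fact E1_mul_jordan x y (m := table_mul E1_table) :
  m (m x x) (m x y) = m x (m (m x x) y).
Proof. rewrite /m; by_coords E1_mulE. Qed.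
Fact E2_mul_jordan x y (m := table_mul E2_table) :
  m (m x x) (m x y) = m x (m (m x x) y).
Proof. rewrite /m; by_coords E2_mulE. Qed.
Fact E3_mul_jordan x y (m := table_mul E3_table) :
  m (m x x) (m x y) = m x (m (m x x) y).
Proof. rewrite /m; by_coords E3_mulE. Qed.
Fact E4_mul_jordan x y (m := table_mul E4_table) :
  m (m x x) (m x y) = m x (m (m x x) y).
Proof. rewrite /m; by_coords E4_mulE. Qed.

Fact E1_mul1 : left_id (b 0 + b 1) (table_mul E1_table).
Proof. move=> x; rewrite [RHS]row4E; by_coords E1_mulE. Qed.
Fact E2_mul1 : left_id (b 0 + b 1) (table_mul E2_table).
Proof. move=> x; rewrite [RHS]row4E; by_coords E2_mulE. Qed.
Fact E3_mul1 : left_id (b 0) (table_mul E3_table).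
Proof. move=> x; rewrite [RHS]row4E; by_coords E3_mulE. Qed.
Fact E4_mul1 : left_id (b 0) (table_mul E4_table).
Proof. move=> x; rewrite [RHS]row4E; by_coords E4_mulE. Qed.

Definition E1 : jordanAlg F :=
  JordanAlg (table_mul_linear E1_table) E1_mulC E1_mul_jordan E1_mul1.
Definition E2 : jordanAlg F :=
  JordanAlg (table_mul_linear E2_table) E2_mulC E2_mul_jordan E2_mul1.
Definition E3 : jordanAlg F :=
  JordanAlg (table_mul_linear E3_table) E3_mulC E3_mul_jordan E3_mul1.
Definition E4 : jordanAlg F :=
  JordanAlg (table_mul_linear E4_table) E4_mulC E4_mul_jordan E4_mul1.

End TableAlgebras.

Section LinearSpaces.
Variable F : numFieldType.

Definition mx4 (s : seq (seq F)) : 'M[F]_4 :=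
  \matrix_(i < 4, j < 4) (nth [::] s i)`_j.

Definition E1_4_1 : set 'M[F]_4 :=
  [set A | exists v w x y, A = mx4 [:: [:: v; w; x; 0];
                                       [:: w; y; 0; 0];
                                       [:: x; 0; 0; 0];
                                       [:: 0; 0; 0; x]]].

Definition E1_4_2 : set 'M[F]_4 :=
  [set A | exists v w x y, A = mx4 [:: [:: v; w; x; 0];
                                       [:: w; y; 0; 0];
                                       [:: x; 0; 0; 0];
                                       [:: 0; 0; 0; y]]].

Definition E2_4 : set 'M[F]_4 :=
  [set A | exists v w x y, A = mx4 [:: [:: v; x; w; 0];
                                       [:: x; 0; 0; 0];
                                       [:: w; 0; 0; y];
                                       [:: 0; 0; y; 0]]].

Definition E3_4 : set 'M[F]_4 :=
  [set A | exists u x y z, A = mx4 [:: [:: y; x; u; z];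
                                       [:: x; u; 0; 0];
                                       [:: u; 0; 0; 0];
                                       [:: z; 0; 0; u]]].

Definition F4 : set 'M[F]_4 :=
  [set A | exists u x y z, A = mx4 [:: [:: x; y; 0; u];
                                       [:: y; z; u; 0];
                                       [:: 0; u; 0; 0];
                                       [:: u; 0; 0; 0]]].

End LinearSpaces.

Arguments E1_4_1 : clear implicits.
Arguments E1_4_2 : clear implicits.
Arguments E2_4 : clear implicits.
Arguments E3_4 : clear implicits.
Arguments F4 : clear implicits.

(* Main.v *)
Require Import Defs.
From mathcomp Require Import all_boot all_order all_algebra.
From mathcomp Require Import classical_sets reals complex.
From HB Require Import structures.
From mathcomp Require Import ring.

Set Implicit Arguments.
Unset Strict Implicit.
Unset Printing Implicit Defensive.

Import GRing.Theory Num.Theory.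
Local Open Scope ring_scope.
Local Open Scope classical_set_scope.

(** An embedding f of a Jordan algebra A with unit matrix U is studied through
    the operators T a = f(a) U^-1 acting on row vectors. They are self-adjoint
    for the nondegenerate symmetric form <p, q> = p U q^T, they satisfy
    T a T b + T b T a = 2 T (ab), and the values of the bilinear form f(a) are
    p f(a) q^T = <p (T a), q>. Choosing a basis of row vectors, taken as the rows
    of P, amounts to passing from f(A) to the congruent space P f(A) P^T, whose
    matrices are the tables (<p_i (T a), p_j>). So each part of the theorem asks
    for a basis in which all the T a are explicit. The bases used are frames:
    each vector pairs to 1 with exactly one partner and to 0 with the others, so
    that coordinates are read off by pairing with the partners. Once f(A) has
    been put inside the expected space of matrices, equality follows because both
    have dimension 4 (congruent_pattern).

    Three kinds of frames suffice.

    - If N is self-adjoint with N^3 = 0 and N^2 <> 0, some p has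
      <p N^2, p> = 1, and p can be corrected so that p, p N, p N^2 has the
      antidiagonal Gram matrix; its orthogonal complement is a line killed by N
      (nilpotent_chain_frame). For E1 take N = W: the idempotent X acts on that
      complement by 0 or 1, whence the two normal forms. For E3 and E4 take
      N = X: an operator Z anticommuting with X and with Z^2 = e X^2 is then
      determined up to two scalars c, d with d^2 = e
      (nilpotent_chain_anticommuting_action). For E4 one has e = 0, so that
      Z = c X^2 contradicts injectivity.

    - For E2 the isotropic vectors p, p V in the 1-eigenspace of X and
      p W in the 0-eigenspace are completed to two hyperbolic planes
      (peirce_frame). The point is to choose p with both <p V, p> and p W
      nonzero (anisotropic_off_kernel).

    - In a two-dimensional space of symmetric forms some member has rank at least
      two (pencil_orthonormal). Hence two independent anticommuting elements of
      square zero have a combination X of square zero and rank two, whose image is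
      Lagrangian, with a frame p, q, q X, p X (square_zero_pencil_frame). In it an
      operator Y anticommuting with X and with Y^2 = e acts on the quotient by
      im X as an antisymmetric 2 x 2 matrix of square e
      (square_zero_anticommuting_action). If e = 0 this matrix vanishes and Y is
      given by a symmetric 2 x 2 matrix; these fill F4, which settles J^3_0. In
      J^3_1 there is moreover an R with R^2 = 1; the symmetric matrices commuting
      with the nonzero antisymmetric matrix of R are scalar, so that the
      square-zero generators are both proportional to X
      (square_zero_commutant). In C x J^2_0 the idempotent E of the first factor
      satisfies E X = X E = 0, so im E is in ker X = im X, which is in ker E, and
      E = E^2 = 0. *)

(** * Symmetric bilinear forms *)

Section Form.
Variables (F : numClosedFieldType) (n : nat).
Implicit Types (S T : 'M[F]_n) (p q x y : 'rV[F]_n).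

Definition bform S p q : F := (p *m S *m q^T) 0 0.

Lemma bformDl S p q x : bform S (p + q) x = bform S p x + bform S q x.
Proof. by rewrite /bform !mulmxDl mxE. Qed.

Lemma bformZl S a p x : bform S (a *: p) x = a * bform S p x.
Proof. by rewrite /bform -!scalemxAl mxE. Qed.

Lemma bformDr S p q x : bform S x (p + q) = bform S x p + bform S x q.
Proof. by rewrite /bform linearD mulmxDr mxE. Qed.

Lemma bformZr S a p x : bform S x (a *: p) = a * bform S x p.
Proof. by rewrite /bform linearZ -scalemxAr mxE. Qed.

Lemma bform0l S x : bform S 0 x = 0.
Proof. by rewrite /bform !mul0mx mxE. Qed.

Lemma bform0r S x : bform S x 0 = 0.
Proof. by rewrite /bform trmx0 mulmx0 mxE. Qed.

Lemma bformDm S T p q : bform (S + T) p q = bform S p q + bform T p q.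
Proof. by rewrite /bform mulmxDr mulmxDl mxE. Qed.

Lemma bformZm a S p q : bform (a *: S) p q = a * bform S p q.
Proof. by rewrite /bform -scalemxAr -scalemxAl mxE. Qed.

Lemma bform_suml S (I : finType) (f : I -> 'rV[F]_n) x :
  bform S (\sum_i f i) x = \sum_i bform S (f i) x.
Proof. by rewrite /bform !mulmx_suml summxE. Qed.

Definition bformE := (bformDl, bformDr, bformZl, bformZr, bform0l, bform0r).

Lemma bformC S p q : S^T = S -> bform S p q = bform S q p.
Proof.
move=> symS; rewrite /bform -[in RHS](trmxK (_ *m _)) [RHS]mxE.
by rewrite !trmx_mul trmxK symS mulmxA.
Qed.

Lemma bform_delta S i j : bform S (delta_mx 0 i) (delta_mx 0 j) = S i j.
Proof. by rewrite /bform -rowE trmx_delta -colE !mxE. Qed.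

Lemma bform_scale1 S p : bform S p p != 0 -> exists a, bform S (a *: p) (a *: p) = 1.
Proof.
move=> nz; exists (sqrtC (bform S p p))^-1; rewrite !bformE mulrA -expr2 exprVn.
by rewrite sqrtCK mulVf.
Qed.

(** By polarization a nonzero symmetric form is not alternating, and over an
    algebraically closed field a nonzero value can be scaled to 1. *)
Lemma bform_represents1 S : S^T = S -> S != 0 -> exists p, bform S p p = 1.
Proof.
move=> symS nzS.
have [p nzp] : exists p, bform S p p != 0.
  have [i [j nzij]] := matrix0Pn _ nzS.
  pose e k : 'rV[F]_n := delta_mx 0 k.
  have [nzi|/negbNE/eqP zi] := boolP (S i i != 0).
    by exists (e i); rewrite bform_delta.
  have [nzj|/negbNE/eqP zj] := boolP (S j j != 0).
    by exists (e j); rewrite bform_delta.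
  exists (e i + e j); rewrite !bformE !bform_delta zi zj add0r addr0.
  have -> : S j i = S i j by rewrite -[in RHS]symS mxE.
  by rewrite -mulr2n mulrn_eq0.
by have [a] := bform_scale1 nzp; exists (a *: p).
Qed.

(** The form S(x, y) - S(x, p) S(p, y), which is S restricted to the orthogonal
    of p, either vanishes or represents 1. *)
Lemma bform_rank1_or_orthonormal S p : S^T = S -> bform S p p = 1 ->
  (exists2 q, bform S q q = 1 & bform S p q = 0) \/
  (forall x y, bform S x y = bform S x p * bform S p y).
Proof.
move=> symS Spp; pose S' := S - S *m p^T *m (p *m S).
have bformS' x y : bform S' x y = bform S x y - bform S x p * bform S p y.
  rewrite /bform mulmxBr mulmxBl [LHS]mxE [X in _ + X]mxE; congr (_ - _).
  have -> : x *m (S *m p^T *m (p *m S)) *m y^T =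
      (x *m S *m p^T) *m (p *m S *m y^T) by rewrite !mulmxA.
  by rewrite mxE big_ord1.
have symS' : S'^T = S' by rewrite /S' linearB /= !trmx_mul trmxK symS mulmxA.
have [S'0|/(bform_represents1 symS')[q]] := eqVneq S' 0.
  right=> x y; apply/eqP; rewrite -subr_eq0 -bformS' S'0.
  by rewrite /bform mulmx0 mul0mx mxE.
rewrite bformS' => S'qq; left; exists (q + - bform S p q *: p).
  rewrite -[RHS]S'qq !bformE Spp (bformC q p symS); ring.
by rewrite !bformE Spp mulr1 subrr.
Qed.

(** The sum of two independent squares of linear forms has rank two, so the
    members of a two-dimensional space of symmetric forms cannot all have rank
    at most one. *)
Lemma pencil_orthonormal S T : S^T = S -> T^T = T -> S != 0 ->
    (forall t, T != t *: S) ->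
  exists s t p q, [/\ bform (s *: S + t *: T) p p = 1,
    bform (s *: S + t *: T) q q = 1 & bform (s *: S + t *: T) p q = 0].
Proof.
move=> symS symT nzS indep; have [p Spp] := bform_represents1 symS nzS.
have [[q Sqq Spq]|rkS] := bform_rank1_or_orthonormal symS Spp.
  by exists 1, 0, p, q; rewrite scale1r scale0r addr0.
(* T' is the member of the pencil for which p is isotropic; if S and T' are both
   squares of linear forms, then S + T' is the required sum. *)
pose T' := - bform T p p *: S + T.
have symT' : T'^T = T' by rewrite linearD linearZ /= symS symT.
have nzT' : T' != 0 by rewrite /T' addrC scaleNr subr_eq0.
have T'pp : bform T' p p = 0 by rewrite bformDm bformZm Spp mulr1 addNr.
have [q T'qq] := bform_represents1 symT' nzT'.
have [[x T'xx T'qx]|rkT'] := bform_rank1_or_orthonormal symT' T'qq.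
  by exists (- bform T p p), 1, q, x; rewrite scale1r -/T'.
have T'qp : bform T' q p = 0.
  by apply/eqP; rewrite -sqrf_eq0 expr2 {1}(bformC q p symT') -rkT' T'pp.
have T'pq : bform T' p q = 0 by rewrite bformC.
exists (1 - bform T p p), 1, p, (q + - bform S p q *: p).
have -> : (1 - bform T p p) *: S + 1 *: T = S + T'.
  by rewrite /T' scalerBl !scale1r scaleNr addrA.
clearbody T'; have Sqp : bform S q p = bform S p q by rewrite bformC.
have Sqq : bform S q q = bform S p q ^+ 2 by rewrite rkS Sqp.
by rewrite !bformDm !bformE Spp T'pp T'qq T'qp T'pq Sqq Sqp; split; ring.
Qed.

End Form.

(** * Self-adjoint operators on row vectors *)

Section SelfAdjoint.
Variables (F : numClosedFieldType) (n : nat) (U : 'M[F]_n).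
Hypotheses (symU : U^T = U) (unitU : U \in unitmx).
Implicit Types (T : 'M[F]_n) (p q x y : 'rV[F]_n).

(** Operators act on row vectors from the right, so this says that
    <x, y T> = <x T, y> for the form <x, y> = x U y^T. *)
Definition self_adjoint T := U *m T^T = T *m U.

Lemma bform_adj T x y :
  self_adjoint T -> bform U x (y *m T) = bform U (x *m T) y.
Proof. by move=> adjT; rewrite /bform trmx_mul -!mulmxA (mulmxA U) adjT !mulmxA. Qed.

Lemma bform_op T x y : bform (T *m U) x y = bform U (x *m T) y.
Proof. by rewrite /bform !mulmxA. Qed.

Lemma self_adjoint_sym T : self_adjoint T -> (T *m U)^T = T *m U.
Proof. by rewrite trmx_mul symU. Qed.

Lemma self_adjoint_sqr T : self_adjoint T -> self_adjoint (T *m T).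
Proof.
by move=> adjT; rewrite /self_adjoint trmx_mul mulmxA adjT -mulmxA adjT mulmxA.
Qed.

Lemma op_represents1 T :
  self_adjoint T -> T != 0 -> exists p, bform U (p *m T) p = 1.
Proof.
move=> adjT nzT.
have nzTU : T *m U != 0 by rewrite -(mul0mx _ U) (can_eq (mulmxK unitU)).
have [p] := bform_represents1 (self_adjoint_sym adjT) nzTU.
by exists p; rewrite -bform_op.
Qed.

Lemma bform_nondegenerate x : x != 0 -> exists y, bform U x y = 1.
Proof.
move=> nzx; have nz : x *m U != 0 by rewrite -(mul0mx _ U) (can_eq (mulmxK unitU)).
have [j nzj] : exists j, (x *m U) 0 j != 0 by apply/rV0Pn.
exists (((x *m U) 0 j)^-1 *: delta_mx 0 j).
by rewrite bformZr /bform trmx_delta -colE [X in _ * X]mxE mulVf.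
Qed.

End SelfAdjoint.

(** * Frames *)

Lemma bform_rows (F : numClosedFieldType) n m k (S : 'M[F]_n)
    (P : 'M[F]_(m, n)) (Q : 'M[F]_(k, n)) i j :
  (P *m S *m Q^T) i j = bform S (row i P) (row j Q).
Proof.
by rewrite /bform -row_mul !mxE; apply: eq_bigr => l _; rewrite !mxE.
Qed.

Section Frame.
Variables (F : numClosedFieldType) (U : 'M[F]_4).
Hypotheses (symU : U^T = U) (unitU : U \in unitmx).
Implicit Types (T X Z : 'M[F]_4) (p q x y : 'rV[F]_4) (s : seq nat) (v : seq 'rV[F]_4).

Definition partner s i := nth 0%N s i.

(** The Gram matrix of a frame is the matrix of an involution of the indices, given
    by the list s of its values so that it computes on concrete indices. *)
Definition frame s v :=
  perm_eq s (iota 0 4) /\ forall i j : 'I_4,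
    partner s (partner s i) = i /\
    bform U v`_i v`_j = (j == partner s i :> nat)%:R.

Definition frame_mx v : 'M[F]_4 := \matrix_(i < 4) v`_i.

Lemma frame_partner_lt s v : frame s v -> forall i : 'I_4, (partner s i < 4)%N.
Proof.
case=> perms _ i; have /perm_mem/(_ (partner s i)) := perms.
by rewrite mem_iota /= => <-; rewrite mem_nth // (perm_size perms) size_iota.
Qed.

(** The Gram matrix being a permutation matrix, the dual basis of a frame consists
    of the partners of its vectors. *)
Lemma frame_mx_expand s v : frame s v ->
  frame_mx v \in unitmx /\
  forall x, x = \sum_(i < 4) bform U x v`_(partner s i) *: v`_i.
Proof.
move=> frv; have lts := frame_partner_lt frv; case: frv => perms frp.
pose P := frame_mx v; pose f (i : 'I_4) := Ordinal (lts i).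
pose Q : 'M[F]_4 := \matrix_(i < 4) v`_(f i).
have PQ : P *m (U *m Q^T) = 1%:M.
  apply/matrixP => i j; rewrite mulmxA bform_rows !rowK !mxE.
  have [_ ->] := frp i (f j); congr (_%:R).
  have [Dj _] := frp j i; have [Di _] := frp i j.
  by rewrite -val_eqE eq_sym /=; congr nat_of_bool; apply/eqP/eqP; congruence.
have [unitP _] := mulmx1_unit PQ; split=> // x.
rewrite -[LHS]mulmx1 -(mulmx1C PQ) mulmxA mulmx_sum_row; apply: eq_bigr => i _.
rewrite rowK mulmxA; congr (_ *: _).
by rewrite bform_rows rowK row_id.
Qed.

Lemma frame_expand s v x : frame s v ->
  x = bform U x v`_(partner s 0) *: v`_0 + bform U x v`_(partner s 1) *: v`_1 +
      bform U x v`_(partner s 2) *: v`_2 + bform U x v`_(partner s 3) *: v`_3.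
Proof.
case/frame_mx_expand=> _ /(_ x) {1}->.
by rewrite !big_ord_recl big_ord0 addr0 !addrA.
Qed.

Lemma frame_op_eq s v T T' :
  frame s v -> (forall i : 'I_4, v`_i *m T = v`_i *m T') -> T = T'.
Proof.
case/frame_mx_expand=> unitP _ eqT; apply: (can_inj (mulKmx unitP)).
by apply/row_matrixP => i; rewrite !row_mul rowK eqT.
Qed.

Lemma frame_bform s v : frame s v -> forall i j : nat, (i < 4)%N -> (j < 4)%N ->
  bform U v`_i v`_j = (j == partner s i)%:R.
Proof. by case=> _ gram i j lti ltj; have [] := gram (Ordinal lti) (Ordinal ltj). Qed.

(** The identity has trace 4, so it differs from the projection, of trace 3,
   onto the span of three vectors with a nondegenerate Gram matrix. *)
Lemma orthogonal_completion p1 p2 p3 :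
    bform U p1 p1 = 0 -> bform U p1 p2 = 0 -> bform U p1 p3 = 1 ->
    bform U p2 p2 = 1 -> bform U p2 p3 = 0 -> bform U p3 p3 = 0 ->
  exists p4, frame [:: 2; 1; 0; 3]%N [:: p1; p2; p3; p4].
Proof.
move=> p11 p12 p13 p22 p23 p33.
(* 1 - U K is the projection onto the orthogonal, and S its form. *)
pose K : 'M_4 := p3^T *m p1 + p2^T *m p2 + p1^T *m p3.
pose S := U - U *m K *m U.
have symK : K^T = K.
  by rewrite !linearD /= !trmx_mul !trmxK addrC (addrC (_ *m p3)) addrA.
have symS : S^T = S by rewrite linearB /= !trmx_mul symU symK mulmxA.
have bformS x y : bform S x y = bform U x y -
    (bform U x p3 * bform U p1 y + bform U x p2 * bform U p2 y +
     bform U x p1 * bform U p3 y).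
  rewrite /bform mulmxBr mulmxBl [LHS]mxE [X in _ + X]mxE; congr (_ - _).
  rewrite mulmxDr mulmxDl mulmxDr mulmxDl mulmxDr mulmxDl mulmxDr mulmxDl.
  have E (a b : 'rV[F]_4) : (x *m (U *m (a^T *m b) *m U) *m y^T) 0 0 =
      (x *m U *m a^T) 0 0 * (b *m U *m y^T) 0 0.
    have -> : x *m (U *m (a^T *m b) *m U) *m y^T =
      (x *m U *m a^T) *m (b *m U *m y^T) by rewrite !mulmxA.
    by rewrite mxE big_ord1.
  by rewrite mxE [X in X + _]mxE !E.
have nzS : S != 0.
  rewrite subr_eq0; apply/eqP => /(congr1 (fun A => \tr (A *m invmx U))).
  (* If S = 0 then U K = 1, but U K has trace 3. *)
  rewrite mulmxK // mulmxV // mxtrace1 mxtrace_mulC.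
  have trK a b : \tr (a^T *m b *m U) = bform U b a.
    by rewrite -mulmxA mxtrace_mulC /mxtrace big_ord1.
  rewrite !mulmxDl !mxtraceD !trK p13 p22 (bformC _ _ symU) p13.
  by move/eqP; rewrite -subr_eq0 (_ : _ - _ = 1) ?oner_eq0 //; ring.
have [q] := bform_represents1 symS nzS; rewrite bformS => Sqq.
exists (q + - bform U q p3 *: p1 + - bform U q p2 *: p2 + - bform U q p1 *: p3).
split=> // i j.
have p21 : bform U p2 p1 = 0 by rewrite bformC.
have p31 : bform U p3 p1 = 1 by rewrite bformC.
have p32 : bform U p3 p2 = 0 by rewrite bformC.
have q1 := bformC p1 q symU; have q2 := bformC p2 q symU.
have q3 := bformC p3 q symU.
case: i j => [[|[|[|[|//]]]] ?] [[|[|[|[|//]]]] ?]; split=> //=;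
  rewrite !bformE ?(p11, p12, p13, p21, p22, p23, p31, p32, p33) //=;
  rewrite ?q1 ?q2 ?q3 -?[RHS]Sqq ?q1 ?q2 ?q3; ring.
Qed.

End Frame.

Arguments frame_bform {F U s v} _ (i j)%_nat_scope _ _.

(** * Normal forms of nilpotent self-adjoint operators *)

Section NormalForms.
Variables (F : numClosedFieldType) (U : 'M[F]_4).
Hypotheses (symU : U^T = U) (unitU : U \in unitmx).
Implicit Types (T W X Y Z : 'M[F]_4) (p q x y : 'rV[F]_4).

Local Notation "<| x , y |>" := (bform U x y) (format "<| x ,  y |>").

(** Adding a multiple of q N^2 to q makes q isotropic without changing q N. The
    line orthogonal to the chain is stable under N, hence killed by it. *)
Lemma nilpotent_chain_frame N q :
    self_adjoint U N -> N *m N *m N = 0 ->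
    <|q *m N *m N, q|> = 1 -> <|q *m N, q|> = 0 ->
  exists b p4, let p := q + b *: (q *m N *m N) in
    frame U [:: 2; 1; 0; 3]%N [:: p; p *m N; p *m N *m N; p4] /\ p4 *m N = 0.
Proof.
move=> adjN N3 qNN qN; have adj x y := bform_adj x y adjN.
have xN3 x : x *m N *m N *m N = 0 by rewrite -!mulmxA (mulmxA N) N3 mulmx0.
pose b := - 2^-1 * <|q, q|>; pose p := q + b *: (q *m N *m N).
have pN : p *m N = q *m N by rewrite mulmxDl -scalemxAl xN3 scaler0 addr0.
have [||||||p4 frp] := @orthogonal_completion _ U symU unitU p (p *m N) (p *m N *m N).
- by rewrite !bformE !adj xN3 qNN bform0l /b; field.
- by rewrite pN !bformE adj qN -!adj xN3 bform0r mulr0 addr0.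
- by rewrite !adj pN !bformE !adj xN3 bform0l qNN mulr0 addr0.
- by rewrite !adj pN !bformE !adj xN3 bform0l qNN mulr0 addr0.
- by rewrite !adj pN xN3 bform0l.
- by rewrite !adj pN xN3 ?mul0mx bform0l.
exists b, p4; split=> //; set c := <|p4 *m N, p4|>.
have p4N : p4 *m N = c *: p4.
  rewrite {1}(frame_expand (p4 *m N) frp) /= -!adj xN3 bform0r !scale0r !add0r.
  have -> : <|p4, p *m N *m N|> = 0 by rewrite (frame_bform frp 3 2).
  have -> : <|p4, p *m N|> = 0 by rewrite (frame_bform frp 3 1).
  by rewrite adj !scale0r !add0r.
have := xN3 p4; rewrite p4N -!scalemxAl p4N -!scalemxAl p4N !scalerA.
move/(congr1 (bform U ^~ p4)); rewrite bformE bform0l.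
rewrite (frame_bform frp 3 3) //= mulr1 => /eqP.
by rewrite !mulf_eq0 !orbb => /eqP->; rewrite scale0r.
Qed.

(** A multiple of q X corrects the value <q X, q>. *)
Lemma nilpotent_frame X :
    self_adjoint U X -> X *m X *m X = 0 -> X *m X != 0 ->
  exists p p4, p4 *m X = 0 /\
    frame U [:: 2; 1; 0; 3]%N [:: p; p *m X; p *m X *m X; p4].
Proof.
move=> adjX X3 nzXX; have aX x y := bform_adj x y adjX.
have [q] := op_represents1 symU unitU (self_adjoint_sqr adjX) nzXX.
rewrite mulmxA => qXX.
have xX3 (x : 'rV[F]_4) : x *m X *m X *m X = 0 by rewrite -!mulmxA (mulmxA X) X3 mulmx0.
pose a := - 2^-1 * <|q *m X, q|>; pose p := q + a *: (q *m X).
have pXXp : <|p *m X *m X, p|> = 1.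
  by rewrite !mulmxDl -!scalemxAl xX3 scaler0 addr0 !bformE aX xX3
    bform0l mulr0 addr0.
have pXp : <|p *m X, p|> = 0.
  by rewrite !mulmxDl -!scalemxAl !bformE !aX xX3 qXX bform0l /a; field.
have [k [p4 [frv p4X]]] := nilpotent_chain_frame adjX X3 pXXp pXp.
by exists (p + k *: (p *m X *m X)), p4.
Qed.

(** The component of p Z on p is <p Z X^2, p> = 0. Its component on p X is
    <p Z X, p> = <p, p X Z> = - <p, p Z X>, hence vanishes too. The two scalars
    left are constrained by Z^2 = e X^2, which also makes <p4 Z, p4> vanish. *)
Lemma nilpotent_chain_anticommuting_action p p4 X Z e :
    let v := [:: p; p *m X; p *m X *m X; p4] in
    frame U [:: 2; 1; 0; 3]%N v ->
    self_adjoint U X -> self_adjoint U Z -> p4 *m X = 0 -> X *m X *m X = 0 ->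
    X *m Z + Z *m X = 0 -> Z *m X *m X = 0 -> Z *m Z = e *: (X *m X) ->
  exists c d, [/\ d ^+ 2 = e, p *m Z = c *: (p *m X *m X) + d *: p4,
    p *m X *m Z = 0, p *m X *m X *m Z = 0 & p4 *m Z = d *: (p *m X *m X)].
Proof.
move=> v frv adjX adjZ p4X X3 XZ ZXX ZZ.
have adX x y := bform_adj x y adjX; have adZ x y := bform_adj x y adjZ.
have xXZ x : x *m X *m Z = - (x *m Z *m X).
  by apply/eqP; rewrite -addr_eq0 -!mulmxA -mulmxDr XZ mulmx0.
have xXXX x : x *m X *m X *m X = 0 by rewrite -!mulmxA (mulmxA X) X3 mulmx0.
have xZXX x : x *m Z *m X *m X = 0 by rewrite -!mulmxA (mulmxA Z) ZXX mulmx0.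
have xZZ x : x *m Z *m Z = e *: (x *m X *m X).
  by rewrite -!mulmxA ZZ -scalemxAr.
set c := <|p *m Z, p|>; set d := <|p *m Z, p4|>.
have pZ : p *m Z = c *: (p *m X *m X) + d *: p4.
  rewrite {1}(frame_expand (p *m Z) frv) /= !adX xZXX bform0l scale0r add0r.
  have -> : <|p *m Z *m X, p|> = 0.
    have : <|p *m Z *m X, p|> = - <|p *m Z *m X, p|>.
      by rewrite -{1}adX bformC // adZ xXZ -scaleN1r bformZl mulN1r.
    by move/eqP; rewrite -addr_eq0 -mulr2n mulrn_eq0 => /eqP.
  by rewrite scale0r add0r.
have pXZ : p *m X *m Z = 0.
  by rewrite xXZ pZ mulmxDl -!scalemxAl p4X xXXX !scaler0 addr0 oppr0.
have pXXZ : p *m X *m X *m Z = 0 by rewrite xXZ pXZ mul0mx oppr0.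
set s := <|p4 *m Z, p4|>.
have p4Z : p4 *m Z = d *: (p *m X *m X) + s *: p4.
  rewrite {1}(frame_expand (p4 *m Z) frv) /= -!adZ pXZ pXXZ !bform0r !scale0r.
  by rewrite !add0r (bformC p4 _ symU) adZ.
have p4XX : p4 *m X *m X = 0 by rewrite p4X mul0mx.
have p4p4 : <|p4, p4|> = 1 by rewrite (frame_bform frv 3 3).
have p3p : <|p *m X *m X, p|> = 1 by rewrite (frame_bform frv 2 0).
have p3p4 : <|p *m X *m X, p4|> = 0 by rewrite (frame_bform frv 2 3).
have s0 : s = 0.
  have := congr1 (bform U ^~ p4) (xZZ p4).
  rewrite p4XX scaler0 p4Z mulmxDl -!scalemxAl pXXZ p4Z !bformE p3p4 p4p4.
  by rewrite !mulr0 mulr1 !add0r => /eqP; rewrite mulf_eq0 orbb => /eqP.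
rewrite s0 scale0r addr0 in p4Z; exists c, d; split=> //.
have := congr1 (bform U ^~ p) (xZZ p).
rewrite pZ mulmxDl -!scalemxAl pXXZ p4Z !bformE p3p !mulr1 mulr0 add0r => <-.
by rewrite expr2.
Qed.

(** Two vectors orthonormal for <x X, y> can be translated along the Lagrangian
    plane im X so as to span a complementary Lagrangian plane. *)
Lemma square_zero_frame X p q :
    self_adjoint U X -> X *m X = 0 ->
    <|p *m X, p|> = 1 -> <|q *m X, q|> = 1 -> <|p *m X, q|> = 0 ->
  exists x y, frame U [:: 3; 2; 1; 0]%N [:: x; y; y *m X; x *m X].
Proof.
move=> adjX X2 pp qq pq; have ad x y := bform_adj x y adjX.
have xXX x : x *m X *m X = 0 by rewrite -mulmxA X2 mulmx0.
have qp : <|q *m X, p|> = 0 by rewrite -ad bformC.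
pose a := - 2^-1 * <|p, p|>; pose b := - 2^-1 * <|p, q|>.
pose c := - 2^-1 * <|q, q|>.
pose x := p + a *: (p *m X) + b *: (q *m X).
pose y := q + b *: (p *m X) + c *: (q *m X).
have xX : x *m X = p *m X.
  by rewrite !mulmxDl -!scalemxAl !xXX !scaler0 !addr0.
have yX : y *m X = q *m X.
  by rewrite !mulmxDl -!scalemxAl !xXX !scaler0 !addr0.
have xp : <|x, p *m X|> = 1 by rewrite ad xX.
have xq : <|x, q *m X|> = 0 by rewrite ad xX.
have yp : <|y, p *m X|> = 0 by rewrite ad yX.
have yq : <|y, q *m X|> = 1 by rewrite ad yX.
have px : <|p *m X, x|> = 1 by rewrite bformC.
have qx : <|q *m X, x|> = 0 by rewrite bformC.
have py : <|p *m X, y|> = 0 by rewrite bformC.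
have qy : <|q *m X, y|> = 1 by rewrite bformC.
have pp' : <|p, p *m X|> = 1 by rewrite ad.
have pq' : <|p, q *m X|> = 0 by rewrite ad.
have qp' : <|q, p *m X|> = 0 by rewrite ad.
have qq' : <|q, q *m X|> = 1 by rewrite ad.
have xr w : <|w, x|> = <|w, p|> + a * <|w, p *m X|> + b * <|w, q *m X|>.
  by rewrite !bformE.
have yr w : <|w, y|> = <|w, q|> + b * <|w, p *m X|> + c * <|w, q *m X|>.
  by rewrite !bformE.
have xx : <|x, x|> = 0.
  by rewrite xr xp xq (bformC x p symU) xr pp' pq' /a; field.
have yy : <|y, y|> = 0.
  by rewrite yr yp yq (bformC y q symU) yr qp' qq' /c; field.
have xy : <|x, y|> = 0.
  by rewrite yr xp xq (bformC x q symU) xr qp' qq' (bformC q p symU) /b; field.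
have yx : <|y, x|> = 0 by rewrite bformC.
exists x, y; rewrite xX yX; split=> // i j.
case: i j => [[|[|[|[|//]]]] ?] [[|[|[|[|//]]]] ?]; split=> //=;
  by rewrite ad xXX bform0l.
Qed.

(** The form <x Y, y X> is alternating because X and Y anticommute; its value s on
    p, q is the entry of the antisymmetric matrix of Y modulo im X. *)
Lemma square_zero_anticommuting_action p q X Y e :
    let v := [:: p; q; q *m X; p *m X] in
    frame U [:: 3; 2; 1; 0]%N v ->
    self_adjoint U X -> self_adjoint U Y -> X *m X = 0 ->
    X *m Y + Y *m X = 0 -> Y *m Y = e%:M ->
  exists s a b c, [/\ s ^+ 2 = - e,
    p *m Y = s *: q + b *: (q *m X) + a *: (p *m X),
    q *m Y = - s *: p + c *: (q *m X) + b *: (p *m X),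
    q *m X *m Y = s *: (p *m X) & p *m X *m Y = - s *: (q *m X)].
Proof.
move=> v frv adjX adjY X2 XY YY.
have adX x y := bform_adj x y adjX; have adY x y := bform_adj x y adjY.
have xXX x : x *m X *m X = 0 by rewrite -mulmxA X2 mulmx0.
have xXY x : x *m X *m Y = - (x *m Y *m X).
  by apply/eqP; rewrite -addr_eq0 -!mulmxA -mulmxDr XY mulmx0.
have skew x y : <|x *m Y, y *m X|> = - <|y *m Y, x *m X|>.
  by rewrite -adY xXY bformC // -scaleN1r bformZl mulN1r -adX.
have skew0 x : <|x *m Y, x *m X|> = 0.
  by have /eqP := skew x x; rewrite -addr_eq0 -mulr2n mulrn_eq0 => /eqP.
set s := <|p *m Y, q *m X|>.
have pY : p *m Y = s *: q + <|p *m Y, q|> *: (q *m X) + <|p *m Y, p|> *: (p *m X).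
  by rewrite {1}(frame_expand (p *m Y) frv) /= skew0 scale0r add0r.
have qY : q *m Y = - s *: p + <|q *m Y, q|> *: (q *m X) + <|p *m Y, q|> *: (p *m X).
  rewrite {1}(frame_expand (q *m Y) frv) /= skew0 scale0r addr0 skew -/s.
  by have -> : <|q *m Y, p|> = <|p *m Y, q|> by rewrite -adY bformC.
have qXY : q *m X *m Y = s *: (p *m X).
  by rewrite xXY qY !mulmxDl -!scalemxAl !xXX !scaler0 !addr0 scaleNr opprK.
have pXY : p *m X *m Y = - s *: (q *m X).
  by rewrite xXY pY !mulmxDl -!scalemxAl !xXX !scaler0 !addr0 scaleNr.
exists s, <|p *m Y, p|>, <|p *m Y, q|>, <|q *m Y, q|>; split=> //.
have := congr1 (fun A => <|p *m A, p *m X|>) YY.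
rewrite /= mulmxA pY !mulmxDl -!scalemxAl qY qXY pXY !bformE mul_mx_scalar.
rewrite bformE (frame_bform frv 0 3) // (frame_bform frv 2 3) //.
rewrite (frame_bform frv 3 3) //= !mulr0 !mulr1 !addr0 => <-.
by rewrite mulrN opprK expr2.
Qed.

(** Modulo im X the operator R is a nonzero antisymmetric 2 x 2 matrix, while Y
    vanishes there and is given by the symmetric matrix with rows (f, g), (g, h).
    Anticommutation of R and Y forces the two matrices to commute, so that the
    second one is scalar. *)
Lemma square_zero_commutant p q X R Y e :
    frame U [:: 3; 2; 1; 0]%N [:: p; q; q *m X; p *m X] ->
    self_adjoint U X -> self_adjoint U R -> self_adjoint U Y ->
    X *m X = 0 -> X *m R + R *m X = 0 -> X *m Y + Y *m X = 0 ->
    R *m R = e%:M -> e != 0 -> Y *m Y = 0 -> R *m Y + Y *m R = 0 ->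
  exists k, Y = k *: X.
Proof.
move=> frv adjX adjR adjY XX XR XY RR nze YY RY.
have xXX x : x *m X *m X = 0 by rewrite -mulmxA XX mulmx0.
have [u [a [b [c [uu pR qR qXR pXR]]]]] :=
  square_zero_anticommuting_action frv adjX adjR XX XR RR.
have nzu : u != 0.
  by apply: contraNneq nze => u0; rewrite -oppr_eq0 -uu u0 expr0n.
have YY0 : Y *m Y = 0%:M by rewrite YY raddf0.
have [o [f [g [h [oo pY qY qXY pXY]]]]] :=
  square_zero_anticommuting_action frv adjX adjY XX XY YY0.
have {oo} o0 : o = 0 by move/eqP: oo; rewrite oppr0 sqrf_eq0 => /eqP.
rewrite o0 oppr0 !scale0r ?add0r in pY qY qXY pXY.
have pRY : u *: (h *: (q *m X) + g *: (p *m X)) +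
    (g *: (u *: (p *m X)) + f *: (- u *: (q *m X))) = 0.
  have := congr1 (mulmx p) RY; rewrite mulmxDr mulmx0 !mulmxA pR pY !mulmxDl.
  by rewrite -!scalemxAl qY qXY pXY qXR pXR !scaler0 !addr0.
have g0 : g = 0.
  have := congr1 (bform U ^~ p) pRY; rewrite !bformE.
  rewrite (frame_bform frv 2 0) // (frame_bform frv 3 0) //=.
  rewrite !mulr0 !mulr1 add0r addr0.
  rewrite [g * u]mulrC -mulr2n => /eqP; rewrite mulrn_eq0 mulf_eq0 (negPf nzu).
  by move/eqP.
have hf : h = f.
  have := congr1 (bform U ^~ q) pRY; rewrite !bformE.
  rewrite (frame_bform frv 2 1) // (frame_bform frv 3 1) //=.
  rewrite g0 !mulr0 !mulr1 ?mul0r addr0 add0r mulrN [f * u]mulrC -mulrBr => /eqP.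
  by rewrite mulf_eq0 (negPf nzu) subr_eq0 => /eqP.
exists f; apply: (frame_op_eq frv) => -[[|[|[|[|//]]]] ?]; rewrite -scalemxAr /=.
- by rewrite pY g0 scale0r add0r.
- by rewrite qY g0 scale0r addr0 hf.
- by rewrite qXY xXX scaler0.
by rewrite pXY xXX scaler0.
Qed.

End NormalForms.

(** * Peirce decomposition *)

Section Peirce.
Variables (F : numFieldType) (n : nat).
Implicit Types E V W : 'M[F]_n.

Lemma peirce0 E V : E *m E = E -> E *m V + V *m E = 0 ->
  E *m V = 0 /\ V *m E = 0.
Proof.
move=> EE EV.
have l : E *m V + E *m V *m E = 0.
  by rewrite -{1}EE -!mulmxA -mulmxDr EV mulmx0.
have r : E *m V *m E + V *m E = 0.
  by rewrite -[X in _ + _ *m X]EE mulmxA -mulmxDl EV mul0mx.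
have eqEV : E *m V = V *m E.
  by apply: (addIr (E *m V *m E)); rewrite l addrC r.
move: EV; rewrite eqEV -mulr2n -scaler_nat => /eqP.
by rewrite scaler_eq0 pnatr_eq0 /= => /eqP.
Qed.

Lemma peirce1 E V : E *m E = E -> E *m V + V *m E = V + V ->
  E *m V = V /\ V *m E = V.
Proof.
move=> EE EV; have [] := @peirce0 (1%:M - E) V.
- by rewrite mulmxBl mul1mx mulmxBr mulmx1 EE subrr subr0.
- by rewrite mulmxBl mulmxBr mul1mx mulmx1 addrACA -opprD EV subrr.
rewrite mulmxBl mulmxBr mul1mx mulmx1 => /eqP l /eqP r; move: l r.
by rewrite !subr_eq0 => /eqP <- /eqP <-.
Qed.

Lemma peirce_half E W : E *m E = E -> E *m W + W *m E = W -> E *m W *m E = 0.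
Proof.
move=> EE EW; apply: (addrI (E *m W)).
by rewrite addr0 -{1}EE -!mulmxA -mulmxDr EW.
Qed.

(** V maps into the 1-eigenspace of E and W exchanges the two eigenspaces, so
    V W and W V have no common block. *)
Lemma peirce1_half_anticommute E V W :
    E *m E = E -> V *m E = V -> E *m W + W *m E = W ->
    V *m W + W *m V = 0 -> V *m W = 0.
Proof.
move=> EE VE EW VW; have WV : W *m V = 0.
  have := congr1 (mulmx^~ E) VW; rewrite mulmxDl mul0mx -(mulmxA W) VE.
  by rewrite -{1}VE -!mulmxA (mulmxA E) (peirce_half EE EW) mulmx0 add0r.
by rewrite -VW WV addr0.
Qed.

End Peirce.

Section PeirceFrame.
Variables (F : numClosedFieldType) (U : 'M[F]_4).
Hypotheses (symU : U^T = U) (unitU : U \in unitmx).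
Implicit Types (V W X : 'M[F]_4) (p q r x y z : 'rV[F]_4).

Local Notation "<| x , y |>" := (bform U x y) (format "<| x ,  y |>").

(** If q K = 0 and <r V, r> = 0, then one of the vectors q + r and q - r will do:
    the values of <x V, x> on them add up to 2. *)
Lemma anisotropic_off_kernel V (K : 'M[F]_4) q r :
    <|q *m V, q|> = 1 -> r *m K != 0 ->
  exists2 x, <|x *m V, x|> != 0 & x *m K != 0.
Proof.
move=> qVq rK; have [qK|?] := eqVneq (q *m K) 0; last first.
  by exists q; rewrite // qVq oner_eq0.
have [rVr|?] := eqVneq <|r *m V, r|> 0; last by exists r.
pose x1 := q + 1 *: r; pose x2 := q + - 1 *: r.
have x1K : x1 *m K != 0 by rewrite /x1 scale1r mulmxDl qK add0r.
have x2K : x2 *m K != 0.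
  by rewrite mulmxDl -scalemxAl qK add0r scaleN1r oppr_eq0.
have [x1V|?] := eqVneq <|x1 *m V, x1|> 0; last by exists x1.
have [x2V|?] := eqVneq <|x2 *m V, x2|> 0; last by exists x2.
have : <|x1 *m V, x1|> + <|x2 *m V, x2|> = 2.
  by rewrite !mulmxDl -!scalemxAl !bformE qVq rVr; ring.
by move/eqP; rewrite x1V x2V addr0 eq_sym pnatr_eq0.
Qed.

(** V lives on the 1-eigenspace of X, so p is taken there, while W exchanges the
    two eigenspaces, so p W is in the 0-eigenspace. As p V and p W are isotropic
    and nonzero, each of the two eigenspaces contains a hyperbolic plane. *)
Lemma peirce_frame X V W :
    self_adjoint U X -> self_adjoint U V -> self_adjoint U W ->
    X *m X = X -> X *m V = V -> V *m X = V -> V *m V = 0 -> V != 0 ->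
    X *m W + W *m X = W -> W *m W = 0 -> V *m W + W *m V = 0 -> W != 0 ->
  exists p y, [/\ frame U [:: 1; 0; 3; 2]%N [:: p; p *m V; y; p *m W],
    p *m X = p, p *m W *m X = 0, y *m X = 0 &
    y *m W = p *m V].
Proof.
move=> adjX adjV adjW XX XV VX VV nzV XW WW VWV nzW.
have XWX := peirce_half XX XW.
have VW := peirce1_half_anticommute XX VX XW VWV.
have aX x y := bform_adj x y adjX; have aV x y := bform_adj x y adjV.
have aW x y := bform_adj x y adjW.
have [q0 Vq0] := op_represents1 symU unitU adjV nzV.
have [r Wr] := op_represents1 symU unitU adjW nzW.
have rXW : r *m (X *m W) != 0.
  apply/eqP => rXW; move/eqP: Wr.
  by rewrite -{1}XW mulmxDr rXW add0r mulmxA -aX -aW -mulmxA rXW bform0r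
    eq_sym oner_eq0.
have [q1 nzVq1 nzWq1] := anisotropic_off_kernel Vq0 rXW.
have [a] : exists a, bform (V *m U) (a *: q1) (a *: q1) = 1.
  by apply: bform_scale1; rewrite bform_op.
rewrite bform_op => Vq; set q := a *: q1 in Vq.
have nza : a != 0.
  apply/eqP => a0; move/eqP: Vq.
  by rewrite /q a0 scale0r mul0mx bform0l eq_sym oner_eq0.
have nzWq : q *m (X *m W) != 0 by rewrite -scalemxAl scaler_eq0 negb_or nza.
clearbody q; pose b := - 2^-1 * <|q *m X, q *m X|>; pose p := q *m X + b *: (q *m V).
have pX : p *m X = p by rewrite mulmxDl -scalemxAl -!mulmxA XX VX.
have pV : p *m V = q *m V.
  by rewrite mulmxDl -scalemxAl -!mulmxA XV VV mulmx0 scaler0 addr0.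
have pW : p *m W = q *m (X *m W).
  by rewrite mulmxDl -scalemxAl -!mulmxA VW mulmx0 scaler0 addr0.
have pWX : p *m W *m X = 0 by rewrite -pX -!mulmxA (mulmxA X) XWX mulmx0.
have pVX : p *m V *m X = p *m V by rewrite -mulmxA VX.
have pVV : p *m V *m V = 0 by rewrite -mulmxA VV mulmx0.
have pVW : p *m V *m W = 0 by rewrite -mulmxA VW mulmx0.
have pWW : p *m W *m W = 0 by rewrite -mulmxA WW mulmx0.
have qVqX : <|q *m V, q *m X|> = 1 by rewrite aX -mulmxA VX.
have qXqV : <|q *m X, q *m V|> = 1 by rewrite bformC.
have qVqV : <|q *m V, q *m V|> = 0 by rewrite aV -mulmxA VV mulmx0 bform0l.
have pp : <|p, p|> = 0 by rewrite !bformE qVqX qXqV qVqV /b; field.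
have pVp : <|p *m V, p|> = 1 by rewrite pV !bformE qVqX qVqV mulr0 addr0.
clearbody p; have nzpW : p *m W != 0 by rewrite pW.
have [z pWz] := bform_nondegenerate unitU nzpW.
pose y0 := z + -1 *: (z *m X).
have y0X : y0 *m X = 0 by rewrite mulmxDl -scalemxAl -mulmxA XX scaleN1r subrr.
have pWy0 : <|p *m W, y0|> = 1 by rewrite !bformE aX pWX bform0l mulr0 addr0.
clearbody y0; pose c := - 2^-1 * <|y0, y0|>; pose y := y0 + c *: (p *m W).
have yX : y *m X = 0 by rewrite mulmxDl -scalemxAl y0X pWX scaler0 addr0.
have pWpW : <|p *m W, p *m W|> = 0 by rewrite aW pWW bform0l.
have pWy : <|p *m W, y|> = 1 by rewrite bformDr bformZr pWy0 pWpW mulr0 addr0.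
have yy : <|y, y|> = 0.
  rewrite bformDr bformZr (bformC y _ symU) (bformC y _ symU) pWy bformDr bformZr.
  by rewrite (bformC y0 (p *m W) symU) pWy0 /c; field.
have fixX x w : x *m X = x -> w *m X = 0 -> <|x, w|> = 0 /\ <|w, x|> = 0.
  by move=> xX wX; rewrite (bformC w) // -xX -aX wX bform0r.
have [py yp] := fixX _ _ pX yX; have [ppW pWp] := fixX _ _ pX pWX.
have [pVy ypV] := fixX _ _ pVX yX; have [pVpW pWpV] := fixX _ _ pVX pWX.
have ypW : <|y, p *m W|> = 1 by rewrite bformC.
have ppV : <|p, p *m V|> = 1 by rewrite bformC.
have pVpV : <|p *m V, p *m V|> = 0 by rewrite aV pVV bform0l.
have fr : frame U [:: 1; 0; 3; 2]%N [:: p; p *m V; y; p *m W].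
  by split=> // i j; case: i j => [[|[|[|[|//]]]] ?] [[|[|[|[|//]]]] ?]; split.
exists p, y; split=> //.
rewrite {1}(frame_expand (y *m W) fr) /= -!aW pWW pVW !bform0r !scale0r ypW.
have -> : <|y, y *m W|> = 0.
  have yWX : y *m W *m X = y *m W.
    by rewrite -[in RHS]XW mulmxDr mulmxA yX mul0mx add0r mulmxA.
  by have [] := fixX _ _ yWX yX.
by rewrite scale1r scale0r add0r !addr0.
Qed.

End PeirceFrame.

(** * Spaces of matrices given by a pattern of coordinates *)

Section Patterns.
Variable F : numClosedFieldType.
Implicit Types (t : seq (seq nat)) (c : 'rV[F]_4).

(** Entry k of t stands for the k-th coordinate of c counted from 1, and entry 0
    for a zero of the matrix. *)
Definition pattern t c : 'M[F]_4 := \matrix_(i < 4, j < 4)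
  [:: 0; coord4 c 0; coord4 c 1; coord4 c 2; coord4 c 3]`_(nth 0%N (nth [::] t i) j).

Fact pattern_linear t : linear (pattern t).
Proof.
move=> a c d; apply/matrixP => i j; rewrite !mxE.
case: (nth 0%N _ _) => [|[|[|[|[|k]]]]] /=; rewrite /coord4 ?mxE //.
  by rewrite mulr0 addr0.
by rewrite nth_nil mulr0 addr0.
Qed.

HB.instance Definition _ t :=
  GRing.isLinear.Build F 'rV[F]_4 'M[F]_4 *:%R (pattern t) (pattern_linear t).

Definition E1_4_1_pattern : seq (seq nat) :=
  [:: [:: 1; 2; 3; 0];
      [:: 2; 4; 0; 0];
      [:: 3; 0; 0; 0];
      [:: 0; 0; 0; 3]]%N.
Definition E1_4_2_pattern : seq (seq nat) :=
  [:: [:: 1; 2; 3; 0];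
      [:: 2; 4; 0; 0];
      [:: 3; 0; 0; 0];
      [:: 0; 0; 0; 4]]%N.
Definition E2_4_pattern : seq (seq nat) :=
  [:: [:: 1; 3; 2; 0];
      [:: 3; 0; 0; 0];
      [:: 2; 0; 0; 4];
      [:: 0; 0; 4; 0]]%N.
Definition E3_4_pattern : seq (seq nat) :=
  [:: [:: 3; 2; 1; 4];
      [:: 2; 1; 0; 0];
      [:: 1; 0; 0; 0];
      [:: 4; 0; 0; 1]]%N.
Definition F4_pattern : seq (seq nat) :=
  [:: [:: 2; 3; 0; 1];
      [:: 3; 4; 1; 0];
      [:: 0; 1; 0; 0];
      [:: 1; 0; 0; 0]]%N.

Lemma range_pattern t (M : F -> F -> F -> F -> seq (seq F)) :
    (forall v w x y, mx4 (M v w x y) = pattern t (row4 [:: v; w; x; y])) ->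
  [set A | exists v w x y, A = mx4 (M v w x y)] = range (pattern t).
Proof.
move=> eqM; apply/seteqP; split=> [_ [v [w [x [y ->]]]]|_ [c _ <-]].
  by rewrite eqM; exists (row4 [:: v; w; x; y]).
exists (coord4 c 0), (coord4 c 1), (coord4 c 2), (coord4 c 3).
by rewrite eqM -row4E.
Qed.

Local Ltac by_pattern :=
  apply: range_pattern => ? ? ? ?;
  apply/matrixP => -[[|[|[|[|//]]]] ?] [[|[|[|[|//]]]] ?];
  by rewrite !mxE //= ?c_row4.

Lemma E1_4_1E : E1_4_1 F = range (pattern E1_4_1_pattern).
Proof. by_pattern. Qed.
Lemma E1_4_2E : E1_4_2 F = range (pattern E1_4_2_pattern).
Proof. by_pattern. Qed.
Lemma E2_4E : E2_4 F = range (pattern E2_4_pattern).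
Proof. by_pattern. Qed.
Lemma E3_4E : E3_4 F = range (pattern E3_4_pattern).
Proof. by_pattern. Qed.
Lemma F4E : F4 F = range (pattern F4_pattern).
Proof. by_pattern. Qed.

End Patterns.

(** * From the action on a frame to a congruence *)

Lemma range_eq_dim (F : fieldType) (V V' W : vectType F)
    (f : {linear V -> W}) (g : {linear V' -> W}) :
    injective f -> \dim {:V} = \dim {:V'} ->
    (forall a, exists c, f a = g c) -> forall c, exists a, g c = f a.
Proof.
move=> injf eqdim subfg c.
have sub : (limg (linfun f) <= limg (linfun g))%VS.
  apply/subvP => _ /memv_imgP[a _ ->]; have [d fad] := subfg a.
  by rewrite lfunE /= fad -(lfunE g) memv_img ?memvf.
have kerf : lker (linfun f) == 0%VS.
  by apply/lker0P => x y; rewrite !lfunE; apply: injf.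
have /eqP eqfg : limg (linfun f) == limg (linfun g).
  have dimf : \dim (limg (linfun f)) = \dim {:V}.
    by rewrite limg_dim_eq // (eqP kerf) capv0.
  by rewrite eqEdim sub dimf eqdim -(limg_ker_dim (linfun g) fullv) leq_addl.
have : linfun g c \in limg (linfun f) by rewrite eqfg memv_img ?memvf.
by case/memv_imgP => a _; rewrite !lfunE => ->; exists a.
Qed.

Section Congruence.
Variables (F : numClosedFieldType) (U : 'M[F]_4).
Implicit Types (T : 'M[F]_4) (C : seq (seq F)).
Implicit Types (s : seq nat) (t : seq (seq nat)) (v : seq 'rV[F]_4).

(** The coefficients are lists, like the vectors, so that concrete tables of them
    compute. *)
Definition acts_by v T (C : seq (seq F)) :=
  forall i : 'I_4, v`_i *m T = \sum_(k < 4) (nth [::] C i)`_k *: v`_k.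

Lemma bform_acts_by s v T C (i j : 'I_4) : frame U s v -> acts_by v T C ->
  bform U (v`_i *m T) v`_j = (nth [::] C i)`_(partner s j).
Proof.
move=> frv ->; have [perms gram] := frv.
have lts : (partner s j < 4)%N by exact: frame_partner_lt frv j.
rewrite bform_suml (bigD1 (Ordinal lts)) //= bformE.
have [sK ->] := gram (Ordinal lts) j.
have [_ _] := gram j j; have [-> _] := gram j j.
rewrite eqxx mulr1 big1 ?addr0 // => k nek; rewrite bformE.
have [kK ->] := gram k j; case: eqP => [jk|_]; last by rewrite mulr0.
by case/eqP: nek; apply: val_inj; rewrite /= jk kK.
Qed.

(** Both spaces have dimension 4, so it is enough to put one inside the other. *)
Lemma congruent_pattern (V : vectType F) (T : {linear V -> 'M[F]_4}) s v t :
    frame U s v -> U \in unitmx -> injective T -> \dim {:V} = 4%N ->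
    (forall a, exists c, forall i j : 'I_4,
      bform U (v`_i *m T a) v`_j = pattern t c i j) ->
  congruent (range (fun a => T a *m U)) (range (pattern t)).
Proof.
move=> frv unitU injT dimV patT; have [unitP _] := frame_mx_expand frv.
set P := frame_mx v in unitP; exists P => //.
have linf : linear (fun a => P *m (T a *m U) *m P^T).
  move=> k a b; rewrite linearP mulmxDl mulmxDr mulmxDl.
  by rewrite -!scalemxAl -!scalemxAr -scalemxAl.
pose f : {linear V -> 'M[F]_4} :=
  HB.pack (fun a => P *m (T a *m U) *m P^T)
    (GRing.isLinear.Build F V 'M[F]_4 *:%R _ linf).
have injf : injective f.
  move=> a b /= /(can_inj (mulmxK _)) eqab; apply: injT.
  apply: (can_inj (mulmxK unitU)); apply: (can_inj (mulKmx unitP)).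
  by apply: eqab; rewrite unitmx_tr.
have patf a : exists c, f a = pattern t c.
  have [c cE] := patT a; exists c; apply/matrixP => i j.
  by rewrite -cE bform_rows !rowK bform_op.
have dim4 : \dim {:V} = \dim {:'rV[F]_4} by rewrite dimV dimvf.
apply/seteqP; split=> [_ [c _ <-]|_ [_ [a _ <-] <-]].
  have [a] := range_eq_dim injf dim4 patf c.
  by move=> ->; exists (T a *m U) => //; exists a.
by have [c] := patf a; rewrite /= => ->; exists c.
Qed.

Lemma congruent_pattern_basis (T : {linear 'rV[F]_4 -> 'M[F]_4}) s v t :
    frame U s v -> U \in unitmx -> injective T ->
    (forall k, (k < 4)%N -> exists C c, acts_by v (T (basis4 F k)) C /\
      forall i j : 'I_4, (nth [::] C i)`_(partner s j) = pattern t c i j) ->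
  congruent (range (fun a => T a *m U)) (range (pattern t)).
Proof.
move=> frv unitU injT actT.
apply: (congruent_pattern frv) => // [|a]; first by rewrite dimvf.
rewrite [a]row_sum_delta.
elim/big_ind: _ => [|x y [c cx] [d dy]|k _].
- by exists 0 => i j; rewrite (linear0 T) mulmx0 bform0l (linear0 (pattern t)) mxE.
- exists (c + d) => i j.
  by rewrite (linearD T) mulmxDr bformDl cx dy (linearD (pattern t)) [RHS]mxE.
have [C [c [actC cC]]] := actT k (ltn_ord k).
exists (a 0 k *: c) => i j.
rewrite (linearZ_LR T) (linearZ_LR (pattern t)) -scalemxAr bformZl [RHS]mxE.
rewrite -cC -(bform_acts_by _ _ frv actC).
by rewrite /basis4 inord_val.
Qed.

End Congruence.

(** * Embeddings as spaces of self-adjoint operators *)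

Section Embeddings.
Variables (F : numClosedFieldType) (A : jordanAlg F) (n : nat).

Definition jordan_representation (U : 'M[F]_n) (T : {linear A -> 'M[F]_n}) :=
  [/\ T (junit A) = 1%:M,
      forall a b, T a *m T b + T b *m T a = 2 *: T (jmul a b),
      injective T & forall a, self_adjoint U (T a)].

Lemma embedding_representation L : is_embedding A L ->
  exists (U : 'M[F]_n) (T : {linear A -> 'M[F]_n}),
    [/\ U^T = U, U \in unitmx, jordan_representation U T &
        L = range (fun a => T a *m U)].
Proof.
case=> U [unitU [f [[fM f1] injf ->]]].
have linT : linear (fun a => sym_val (f a) *m invmx (sym_val U)).
  by move=> k a b; rewrite linearP /= mulmxDl -scalemxAl.
pose T : {linear A -> 'M[F]_n} :=
  HB.pack (fun a => sym_val (f a) *m invmx (sym_val U))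
    (GRing.isLinear.Build F A 'M[F]_n *:%R _ linT).
exists U, T; split=> //; first exact: sym_trmx.
- split=> [|a b|a b|a] /=.
  + by rewrite f1 /= mulmxV.
  + rewrite fM /= -scalemxAl scalerA divff ?pnatr_eq0 // scale1r.
    by rewrite mulmxDl !mulmxA.
  + move/(can_inj (mulmxKV unitU)) => eqab; apply: injf; exact: val_inj.
  by rewrite /self_adjoint trmx_mul trmx_inv !sym_trmx mulKVmx // mulmxKV.
by apply: eq_imagel => a _ /=; rewrite mulmxKV.
Qed.

End Embeddings.

Section RepresentationTheory.
Variables (F : numClosedFieldType) (A : jordanAlg F) (n : nat).
Variables (U : 'M[F]_n) (T : {linear A -> 'M[F]_n}).
Hypothesis repT : jordan_representation U T.

Lemma rep_sqr a : T a *m T a = T (jmul a a).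
Proof.
have [_ mulT _ _] := repT; have := mulT a a; rewrite -mulr2n -scaler_nat.
by move/(scalerI _); apply; rewrite pnatr_eq0.
Qed.

Lemma rep_anticommute a b : jmul a b = 0 -> T a *m T b + T b *m T a = 0.
Proof. by have [_ mulT _ _] := repT; rewrite mulT => ->; rewrite linear0 scaler0. Qed.

Lemma rep_peirce1 a b : jmul a a = a -> jmul a b = b ->
  T a *m T b = T b /\ T b *m T a = T b.
Proof.
move=> aa ab; have [_ mulT _ _] := repT.
by apply: peirce1; rewrite ?rep_sqr ?aa // mulT ab scaler_nat mulr2n.
Qed.

Lemma rep_peirce_half a b :
  jmul a b = 2^-1 *: b -> T a *m T b + T b *m T a = T b.
Proof.
move=> ab; have [_ mulT _ _] := repT.
by rewrite mulT ab linearZ scalerA divff ?pnatr_eq0 // scale1r.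
Qed.

Lemma rep_neq0 a : a != 0 -> T a != 0.
Proof.
have [_ _ injT _] := repT.
by apply: contra_neq => Ta; apply: injT; rewrite Ta linear0.
Qed.

End RepresentationTheory.

Lemma table_mul_basis (F : numFieldType) (t : seq (seq 'rV[F]_4)) i j :
  (i < 4)%N -> (j < 4)%N ->
  table_mul t (basis4 F i) (basis4 F j) = (nth [::] t i)`_j.
Proof.
move=> lti ltj; rewrite /table_mul (bigD1 (inord i)) //= (bigD1 (inord j)) //=.
rewrite !mxE !eqxx !inordK // mulr1 scale1r !big1 ?addr0 // => k nek.
  apply: big1 => l _; rewrite !mxE (negPf nek) mul0r scale0r //.
by rewrite !mxE (negPf nek) mulr0 scale0r.
Qed.

Lemma nilpotent_anticommuting_frame (F : numClosedFieldType) (A : jordanAlg F)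
    (U : 'M[F]_4) (T : {linear A -> 'M[F]_4}) (x z : A) e (X := T x) (Z := T z) :
    U^T = U -> U \in unitmx -> jordan_representation U T ->
    jmul x (jmul x x) = 0 -> jmul x x != 0 -> jmul x z = 0 ->
    jmul (jmul x x) z = 0 -> jmul z z = e *: jmul x x ->
  exists p p4 c d, [/\ frame U [:: 2; 1; 0; 3]%N [:: p; p *m X; p *m X *m X; p4],
    X *m X *m X = 0, p4 *m X = 0 & [/\ d ^+ 2 = e,
    p *m Z = c *: (p *m X *m X) + d *: p4, p *m X *m Z = 0,
    p *m X *m X *m Z = 0 & p4 *m Z = d *: (p *m X *m X)]].
Proof.
move=> symU unitU repT x3 nzxx xz xxz zz; have [_ _ _ adjT] := repT.
have XX : X *m X = T (jmul x x) by rewrite (rep_sqr repT).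
have X3 : X *m X *m X = 0.
  have := rep_anticommute repT x3; rewrite -XX mulmxA -mulr2n -scaler_nat => /eqP.
  by rewrite scaler_eq0 pnatr_eq0 => /eqP.
have XZ : X *m Z + Z *m X = 0 by exact: (rep_anticommute repT xz).
have ZXX : Z *m X *m X = 0.
  have xXZ : X *m Z = - (Z *m X) by apply/eqP; rewrite -addr_eq0 XZ.
  have := rep_anticommute repT xxz; rewrite -XX -mulmxA -/Z xXZ mulmxN !mulmxA.
  rewrite xXZ mulNmx opprK -mulr2n -scaler_nat => /eqP.
  by rewrite scaler_eq0 pnatr_eq0 => /eqP.
have ZZ : Z *m Z = e *: (X *m X) by rewrite XX -linearZ -zz (rep_sqr repT).
have [|p [p4 [p4X frv]]] := nilpotent_frame symU unitU (adjT x) X3.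
  by rewrite XX (rep_neq0 repT).
have [c [d act]] := nilpotent_chain_anticommuting_action symU frv
  (adjT x) (adjT z) p4X X3 XZ ZXX ZZ.
by exists p, p4, c, d.
Qed.

(** Every combination of a and b has square zero, so the only condition to meet
    is that T x has rank two. *)
Lemma square_zero_pencil_frame (F : numClosedFieldType) (A : jordanAlg F)
    (U : 'M[F]_4) (T : {linear A -> 'M[F]_4}) (a b : A) :
    U^T = U -> U \in unitmx -> jordan_representation U T ->
    jmul a a = 0 -> jmul a b = 0 -> jmul b b = 0 ->
    a != 0 -> (forall t, b != t *: a) ->
  exists s t p q, let X := T (s *: a + t *: b) in X *m X = 0 /\
    frame U [:: 3; 2; 1; 0]%N [:: p; q; q *m X; p *m X].
Proof.
move=> symU unitU repT aa ab bb nza indep; have [_ mulT injT adjT] := repT.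
have sym c : (T c *m U)^T = T c *m U by exact: self_adjoint_sym (adjT c).
have [||s [t [p [q]]]] := pencil_orthonormal (sym a) (sym b).
- by rewrite -(mul0mx _ U) (can_eq (mulmxK unitU)) (rep_neq0 repT).
- move=> t; apply: contra (indep t) => /eqP.
  by rewrite scalemxAl -linearZ => /(can_inj (mulmxK unitU))/injT->.
rewrite !scalemxAl -!linearZ -mulmxDl -linearD !bform_op.
set x := s *: a + t *: b => -[pp qq pq].
have Tsq : T x *m T x = 0.
  have TT c : jmul c c = 0 -> T c *m T c = 0.
    by move=> cc; rewrite (rep_sqr repT) cc linear0.
  rewrite linearD !linearZ_LR mulmxDl !mulmxDr -!scalemxAl -!scalemxAr !TT //.
  rewrite !scaler0 add0r addr0 !scalerA [t * s]mulrC -scalerDr.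
  by rewrite (rep_anticommute repT ab) scaler0.
have [y [z frv]] := square_zero_frame symU (adjT x) Tsq pp qq pq.
by exists s, t, y, z.
Qed.

(** * The algebras *)

Ltac table_action rules :=
  move=> [[|[|[|[|//]]]] ?]; rewrite !big_ord_recl big_ord0 /=;
  rewrite ?rules; rewrite ?(scale1r, scale0r, addr0, add0r, subr0, subrr) //.

Ltac table_pattern :=
  by move=> [[|[|[|[|//]]]] ?] [[|[|[|[|//]]]] ?]; rewrite mxE /= ?c_row4.

Section Algebras.
Variable F : numClosedFieldType.
Local Notation b := (basis4 F).

Lemma basis4_neq0 k : b k != 0.
Proof. by apply/rV0Pn; exists (inord k); rewrite mxE !eqxx oner_eq0. Qed.

Lemma E1_embeddings (L : set 'M[F]_4) : is_embedding (E1 F) L ->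
  congruent L (E1_4_1 F) \/ congruent L (E1_4_2 F).
Proof.
case/embedding_representation=> U [T [symU unitU repT ->]].
have [T1 mulT injT adjT] := repT; rewrite E1_4_1E E1_4_2E.
pose X := T (b 0); pose Y := T (b 1); pose V := T (b 2); pose W := T (b 3).
have XX : X *m X = X by rewrite (rep_sqr repT) [jmul _ _]table_mul_basis.
have YX : Y = 1%:M - X by rewrite -T1 linearD addrC addKr.
have [XV VX] : X *m V = V /\ V *m X = V.
  by apply: (rep_peirce1 repT); rewrite [LHS]table_mul_basis.
have XW : X *m W + W *m X = W.
  by apply: (rep_peirce_half repT); rewrite [LHS]table_mul_basis.
have WW : W *m W = V by rewrite (rep_sqr repT) [jmul _ _]table_mul_basis.
have VW : V *m W = 0.
  apply: (peirce1_half_anticommute XX VX XW); apply: (rep_anticommute repT).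
  by rewrite [jmul _ _]table_mul_basis.
have nzV : V != 0 by exact/(rep_neq0 repT)/basis4_neq0.
have aX x y := bform_adj x y (adjT (b 0) : self_adjoint U X).
have XWX := peirce_half XX XW.
have [q0 Vq0] := op_represents1 symU unitU (adjT _) nzV.
pose q := q0 *m X.
have qX : q *m X = q by rewrite -mulmxA XX.
have qWX : q *m W *m X = 0 by rewrite -!mulmxA (mulmxA X) XWX mulmx0.
have [] := @nilpotent_chain_frame _ U symU unitU W q (adjT _).
- by rewrite WW VW.
- by rewrite -mulmxA WW aX -!mulmxA VX XV.
- by rewrite -qX aX qX qWX bform0l.
move=> k [p4]; rewrite /= -!(mulmxA _ W) WW.
set p := q + _ => -[frv p4W].
have pX : p *m X = p by rewrite mulmxDl qX -scalemxAl -mulmxA VX.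
clearbody p; clear q Vq0 qX qWX.
have pWX : p *m W *m X = 0 by rewrite -pX -!mulmxA (mulmxA X) XWX mulmx0.
have pVX : p *m V *m X = p *m V by rewrite -mulmxA VX.
have pVW : p *m V *m W = 0 by rewrite -mulmxA VW mulmx0.
have pWW : p *m W *m W = p *m V by rewrite -mulmxA WW.
have p4V : p4 *m V = 0 by rewrite -WW mulmxA p4W mul0mx.
have pVV : p *m V *m V = 0 by rewrite -WW mulmxA WW pVW mul0mx.
have pWV : p *m W *m V = 0 by rewrite -VX -WW !mulmxA pWW pVW mul0mx.
(* X preserves the chain, hence also the line orthogonal to it. *)
have [c p4X] : exists c, p4 *m X = c *: p4.
  exists (bform U (p4 *m X) p4).
  rewrite {1}(frame_expand (p4 *m X) frv) /= -!aX pX pWX pVX bform0r.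
  rewrite (frame_bform frv 3 2) // (frame_bform frv 3 0) //=.
  by rewrite !scale0r !add0r.
have xY (x : 'rV[F]_4) : x *m Y = x - x *m X by rewrite YX mulmxBr mulmx1.
have cc : c * c = c.
  have := congr1 (fun A => bform U (p4 *m A) p4) XX; rewrite mulmxA p4X.
  by rewrite -scalemxAl p4X scalerA !bformE (frame_bform frv 3 3) //= !mulr1.
have p4Y : p4 *m Y = (1 - c) *: p4 by rewrite xY p4X scalerBl scale1r.
set v := [:: p; _; _; _] in frv.
have actX : acts_by v X
    [:: [:: 1; 0; 0; 0]; [:: 0; 0; 0; 0]; [:: 0; 0; 1; 0]; [:: 0; 0; 0; c]].
  table_action (pX, pWX, pVX, p4X).
have actY : acts_by v Y
    [:: [:: 0; 0; 0; 0]; [:: 0; 1; 0; 0]; [:: 0; 0; 0; 0]; [:: 0; 0; 0; 1 - c]].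
  table_action (p4Y, xY, pX, pWX, pVX).
have actV : acts_by v V
    [:: [:: 0; 0; 1; 0]; [:: 0; 0; 0; 0]; [:: 0; 0; 0; 0]; [:: 0; 0; 0; 0]].
  table_action (pWV, pVV, p4V).
have actW : acts_by v W
    [:: [:: 0; 1; 0; 0]; [:: 0; 0; 1; 0]; [:: 0; 0; 0; 0]; [:: 0; 0; 0; 0]].
  table_action (pWW, pVW, p4W).
have {cc} : c = 0 \/ c = 1.
  apply/pred2P; rewrite -subr_eq0 -[c == 1]subr_eq0 -mulf_eq0 subr0 mulrBr mulr1.
  by rewrite cc subrr.
case=> c01; [right|left]; rewrite c01 ?subr0 ?subrr in actX actY;
  (apply: (congruent_pattern_basis frv unitU injT) => -[|[|[|[|//]]]] _;
  [ eexists; exists (row4 [:: 0; 0; 1; 0]); split; [exact: actX | table_pattern]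
  | eexists; exists (row4 [:: 0; 0; 0; 1]); split; [exact: actY | table_pattern]
  | eexists; exists (row4 [:: 1; 0; 0; 0]); split; [exact: actV | table_pattern]
  | eexists; exists (row4 [:: 0; 1; 0; 0]); split; [exact: actW | table_pattern]]).
Qed.

Lemma E2_embeddings (L : set 'M[F]_4) :
  is_embedding (E2 F) L -> congruent L (E2_4 F).
Proof.
case/embedding_representation=> U [T [symU unitU repT ->]].
have [T1 mulT injT adjT] := repT; rewrite E2_4E.
pose X := T (b 0); pose Y := T (b 1); pose V := T (b 2); pose W := T (b 3).
have XX : X *m X = X by rewrite (rep_sqr repT) [jmul _ _]table_mul_basis.
have YX : Y = 1%:M - X by rewrite -T1 linearD addrC addKr.
have xY x : x *m Y = x - x *m X by rewrite YX mulmxBr mulmx1.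
have [XV VX] : X *m V = V /\ V *m X = V.
  by apply: (rep_peirce1 repT); rewrite [LHS]table_mul_basis.
have XW : X *m W + W *m X = W.
  by apply: (rep_peirce_half repT); rewrite [LHS]table_mul_basis.
have VV : V *m V = 0.
  by rewrite (rep_sqr repT) [jmul _ _]table_mul_basis // linear0.
have WW : W *m W = 0.
  by rewrite (rep_sqr repT) [jmul _ _]table_mul_basis // linear0.
have VWV : V *m W + W *m V = 0.
  by apply: (rep_anticommute repT); rewrite [jmul _ _]table_mul_basis.
have VW := peirce1_half_anticommute XX VX XW VWV.
have [||p [y [frv pX pWX yX yW]]] := peirce_frame symU unitU
  (adjT _) (adjT _) (adjT _) XX XV VX VV _ XW WW VWV _;
  try exact/(rep_neq0 repT)/basis4_neq0.
have pVX : p *m V *m X = p *m V by rewrite -mulmxA VX.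
have pVV : p *m V *m V = 0 by rewrite -mulmxA VV mulmx0.
have pVW : p *m V *m W = 0 by rewrite -mulmxA VW mulmx0.
have pWW : p *m W *m W = 0 by rewrite -mulmxA WW mulmx0.
have yV : y *m V = 0 by rewrite -XV mulmxA yX mul0mx.
have pWV : p *m W *m V = 0 by rewrite -XV mulmxA pWX mul0mx.
apply: (congruent_pattern_basis frv unitU injT) => -[|[|[|[|//]]]] _.
- exists [:: [:: 1; 0; 0; 0]; [:: 0; 1; 0; 0]; [:: 0; 0; 0; 0]; [:: 0; 0; 0; 0]],
    (row4 [:: 0; 0; 1; 0]); split; last table_pattern.
  table_action (pX, pVX, yX, pWX).
- exists [:: [:: 0; 0; 0; 0]; [:: 0; 0; 0; 0]; [:: 0; 0; 1; 0]; [:: 0; 0; 0; 1]],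
    (row4 [:: 0; 0; 0; 1]); split; last table_pattern.
  table_action (xY, pX, pVX, yX, pWX).
- exists [:: [:: 0; 1; 0; 0]; [:: 0; 0; 0; 0]; [:: 0; 0; 0; 0]; [:: 0; 0; 0; 0]],
    (row4 [:: 1; 0; 0; 0]); split; last table_pattern.
  table_action (pVV, yV, pWV).
exists [:: [:: 0; 0; 0; 1]; [:: 0; 0; 0; 0]; [:: 0; 1; 0; 0]; [:: 0; 0; 0; 0]],
  (row4 [:: 0; 1; 0; 0]); split; last table_pattern.
table_action (pVW, yW, pWW).
Qed.

Lemma E3_embeddings (L : set 'M[F]_4) :
  is_embedding (E3 F) L -> congruent L (E3_4 F).
Proof.
case/embedding_representation=> U [T [symU unitU repT ->]].
have [T1 mulT injT adjT] := repT; rewrite E3_4E.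
pose X := T (b 1); pose Y := T (b 2); pose Z := T (b 3).
have xx : @jmul _ (E3 F) (b 1) (b 1) = b 2 by rewrite [LHS]table_mul_basis.
have := @nilpotent_anticommuting_frame _ (E3 F) U T (b 1) (b 3) 1 symU unitU repT.
rewrite xx ![jmul _ _]table_mul_basis //= scale1r basis4_neq0.
case=> // p [p4 [c [d [frv X3 p4X [_ pZ pXZ pXXZ p4Z]]]]].
have XX : X *m X = Y by rewrite (rep_sqr repT) xx.
have xY x : x *m Y = x *m X *m X by rewrite -XX mulmxA.
have pXXX : p *m X *m X *m X = 0 by rewrite -!mulmxA (mulmxA X) X3 mulmx0.
apply: (congruent_pattern_basis frv unitU injT) => -[|[|[|[|//]]]] _.
- exists [:: [:: 1; 0; 0; 0]; [:: 0; 1; 0; 0]; [:: 0; 0; 1; 0]; [:: 0; 0; 0; 1]],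
    (row4 [:: 1; 0; 0; 0]); split; last table_pattern.
  have xU (x : 'rV[F]_4) : x *m T (b 0) = x by rewrite [T _]T1 mulmx1.
  table_action xU.
- exists [:: [:: 0; 1; 0; 0]; [:: 0; 0; 1; 0]; [:: 0; 0; 0; 0]; [:: 0; 0; 0; 0]],
    (row4 [:: 0; 1; 0; 0]); split; last table_pattern.
  table_action (pXXX, p4X).
- exists [:: [:: 0; 0; 1; 0]; [:: 0; 0; 0; 0]; [:: 0; 0; 0; 0]; [:: 0; 0; 0; 0]],
    (row4 [:: 0; 0; 1; 0]); split; last table_pattern.
  table_action (xY, p4X, pXXX, mul0mx).
exists [:: [:: 0; 0; c; d]; [:: 0; 0; 0; 0]; [:: 0; 0; 0; 0]; [:: 0; 0; d; 0]],
  (row4 [:: 0; 0; c; d]); split; last table_pattern.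
table_action (pZ, pXZ, pXXZ, p4Z).
Qed.

Lemma E4_not_embedded (L : set 'M[F]_4) : ~ is_embedding (E4 F) L.
Proof.
case/embedding_representation=> U [T [symU unitU repT _]].
have [_ mulT injT adjT] := repT.
pose X := T (b 1); pose Y := T (b 2); pose Z := T (b 3).
have xx : @jmul _ (E4 F) (b 1) (b 1) = b 2 by rewrite [LHS]table_mul_basis.
have := @nilpotent_anticommuting_frame _ (E4 F) U T (b 1) (b 3) 0 symU unitU repT.
rewrite xx ![jmul _ _]table_mul_basis //= scale0r basis4_neq0.
case=> // p [p4 [c [d [frv X3 p4X [d2 pZ pXZ pXXZ p4Z]]]]].
have XX : X *m X = Y by rewrite (rep_sqr repT) xx.
have xY x : x *m Y = x *m X *m X by rewrite -XX mulmxA.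
have pXXX : p *m X *m X *m X = 0 by rewrite -!mulmxA (mulmxA X) X3 mulmx0.
move/eqP: d2; rewrite sqrf_eq0 => /eqP d0.
have ZY : Z = c *: Y.
  apply: (frame_op_eq frv) => -[[|[|[|[|//]]]] ?]; rewrite -scalemxAr /= xY.
  - by rewrite pZ d0 scale0r addr0.
  - by rewrite pXZ pXXX scaler0.
  - by rewrite pXXZ pXXX mul0mx scaler0.
  by rewrite p4Z d0 p4X mul0mx scale0r scaler0.
have /rowP/(_ (inord 3)) : b 3 = c *: b 2 by apply: injT; rewrite linearZ.
rewrite !mxE !eqxx -val_eqE /= !inordK //= mulr0 => /eqP.
by rewrite oner_eq0.
Qed.

Definition J_gen d r (i : 'I_d) : J F d r := (0, delta_mx 0 i).

Lemma J_mul_vec d r (v w : 'rV[F]_d) :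
  @jmul _ (J F d r) (0, v) (0, w) = (spin_form r v w, 0).
Proof. by congr pair; rewrite /= ?mul0r ?add0r // !scale0r addr0. Qed.

Lemma J_mul_gen d r (i : 'I_d) (v : 'rV[F]_d) :
  (r <= i)%N -> jmul (J_gen r i) (0, v) = 0.
Proof.
move=> ri; rewrite J_mul_vec /spin_form big1 // => k kr; rewrite mxE eqxx /=.
by case: eqP => [ki|_]; [move: ri; rewrite -ki leqNgt kr | rewrite mul0r].
Qed.

Lemma J0_mul_vec d (v w : 'rV[F]_d) : @jmul _ (J F d 0) (0, v) (0, w) = 0.
Proof. by rewrite J_mul_vec [spin_form _ _ _]big_pred0. Qed.

Lemma J_gen_neq0 d r (i : 'I_d) : J_gen r i != 0.
Proof.
apply/eqP => /(congr1 (fun a : F^o * 'rV[F]_d => a.2 0 i)); rewrite !mxE !eqxx => /eqP.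
by rewrite oner_eq0.
Qed.

Lemma J_gen_free d r (i j : 'I_d) t : i != j -> J_gen r j != t *: J_gen r i.
Proof.
move=> neij; apply/eqP => /(congr1 (fun a : F^o * 'rV[F]_d => a.2 0 j)).
by rewrite !mxE !eqxx /= eq_sym (negPf neij) mulr0 => /eqP; rewrite oner_eq0.
Qed.

Lemma J3_0_embeddings (L : set 'M[F]_4) :
  is_embedding (J F 3 0) L -> congruent L (F4 F).
Proof.
case/embedding_representation=> U [T [symU unitU repT ->]].
have [T1 mulT injT adjT] := repT; rewrite F4E.
have [s [t [p [q [XX frv]]]]] := square_zero_pencil_frame symU unitU repT
  (@J_mul_gen 3 0 0 _ isT) (@J_mul_gen 3 0 0 _ isT) (@J_mul_gen 3 0 1 _ isT)
  (@J_gen_neq0 3 0 0) (fun k => @J_gen_free 3 0 0 1 k isT).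
move: XX frv; set x := s *: _ + _ => XX frv.
have xE : x = (0, x.2).
  by rewrite [LHS]surjective_pairing; congr pair; rewrite /= !scaler0 addr0.
pose J30 : vectType F := (F^o * 'rV[F]_3)%type.
have dimJ : \dim {:J30} = 4%N by rewrite dimvf.
apply: (@congruent_pattern _ _ J30 T _ _ _ frv unitU injT dimJ) => -[l w].
have YY : T (0, w) *m T (0, w) = 0%:M.
  by rewrite (rep_sqr repT) J0_mul_vec linear0 raddf0.
have XY : T x *m T (0, w) + T (0, w) *m T x = 0.
  by apply: (rep_anticommute repT); rewrite xE J0_mul_vec.
have [u [a [b' [c [u0 pY qY qXY pXY]]]]] :=
  square_zero_anticommuting_action symU frv (adjT x) (adjT (0, w)) XX XY YY.
have {}u0 : u = 0 by move/eqP: u0; rewrite oppr0 sqrf_eq0 => /eqP.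
rewrite u0 ?oppr0 !scale0r ?add0r in pY qY qXY pXY.
have Ta y : y *m T (l, w) = l *: y + y *m T (0, w).
  have -> : (l, w) = l *: junit (J F 3 0) + (0, w).
    by congr pair; rewrite /= ?scaler0 ?add0r // addr0 [RHS]mulr1.
  by rewrite linearD linearZ T1 mulmxDr -scalemxAr mulmx1.
exists (row4 [:: l; a; b'; c]) => i j.
rewrite (@bform_acts_by _ _ _ _ _ [:: [:: l; 0; b'; a]; [:: 0; l; c; b'];
  [:: 0; 0; l; 0]; [:: 0; 0; 0; l]] i j frv).
  by move: i j; table_pattern.
table_action (Ta, pY, qY, qXY, pXY).
Qed.

Lemma jmul0 (A : jordanAlg F) (y : A) : jmul y 0 = 0.
Proof.
by have := jmul_linear y (-1) 0 0; rewrite scaler0 addr0 scaleN1r addNr.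
Qed.

Lemma jmul_comb0 (A : jordanAlg F) (y u v : A) s t :
  jmul y u = 0 -> jmul y v = 0 -> jmul y (s *: u + t *: v) = 0.
Proof.
move=> yu yv; rewrite jmul_linear yu scaler0 add0r.
by rewrite -[t *: v]addr0 jmul_linear yv jmul0 scaler0 addr0.
Qed.

Lemma J3_1_not_embedded (L : set 'M[F]_4) : ~ is_embedding (J F 3 1) L.
Proof.
case/embedding_representation=> U [T [symU unitU repT _]].
have [T1 mulT injT adjT] := repT.
pose r : J F 3 1 := J_gen 1 0; pose a : J F 3 1 := J_gen 1 1.
pose b2 : J F 3 1 := J_gen 1 2.
have aM v : @jmul _ (J F 3 1) a (0, v) = 0 by rewrite J_mul_gen.
have bM v : @jmul _ (J F 3 1) b2 (0, v) = 0 by rewrite J_mul_gen.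
have indep t : b2 != t *: a by exact: (@J_gen_free 3 1 1 2 t isT).
have [s [t [p [q [XX frv]]]]] := square_zero_pencil_frame symU unitU repT
  (aM _) (aM _) (bM _) (@J_gen_neq0 3 1 1) indep.
move: XX frv; set x := s *: _ + _ => XX frv.
have lin y := @jmul_comb0 _ y a b2 s t.
have RR : T r *m T r = 1%:M.
  rewrite (rep_sqr repT) -T1 J_mul_vec; congr (T (_, _)).
  by rewrite /spin_form big_mkcond !big_ord_recl big_ord0 /= !mxE /= mulr1 !addr0.
(* Both square-zero generators satisfy the hypotheses on y, so that they would be
   proportional. *)
have line y : jmul y y = 0 -> jmul y a = 0 -> jmul y b2 = 0 -> jmul r y = 0 ->
    exists c, y = c *: x.
  move=> yy ya yb ry.
  have YY : T y *m T y = 0 by rewrite (rep_sqr repT) yy linear0.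
  have XR : T x *m T r + T r *m T x = 0.
    by rewrite addrC; apply: (rep_anticommute repT); apply: lin;
      rewrite jmulC [LHS]J_mul_gen.
  have XY : T x *m T y + T y *m T x = 0.
    by rewrite addrC; apply: (rep_anticommute repT); exact: lin.
  have [c Yc] := square_zero_commutant symU frv (adjT _) (adjT _) (adjT _)
    XX XR XY RR (oner_neq0 _) YY (rep_anticommute repT ry).
  by exists c; apply: injT; rewrite linearZ.
have ra : jmul r a = 0 by rewrite jmulC; apply: aM.
have rb : jmul r b2 = 0 by rewrite jmulC; apply: bM.
have [c ac] := line a (aM _) (aM _) (aM _) ra.
have [d bd] := line b2 (bM _) (bM _) (bM _) rb.
have nzc : c != 0.
  apply/eqP => c0; move: (@J_gen_neq0 3 1 1); by rewrite -/a ac c0 scale0r eqxx.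
move: (indep (d / c)); by rewrite {1}bd ac scalerA divfK // eqxx.
Qed.

Lemma C_J2_0_not_embedded (L : set 'M[F]_4) :
  ~ is_embedding (prod_jordan (field_jordan F) (J F 2 0)) L.
Proof.
set A := prod_jordan _ _.
case/embedding_representation=> U [T [symU unitU repT _]].
have [T1 mulT injT adjT] := repT.
pose inJ v : A := (0, (0, v)); pose e : A := (1, 0).
have mul0 v w : jmul (inJ v) (inJ w) = 0.
  congr pair; first exact: mul0r.
  exact: J0_mul_vec.
have nz i : inJ (delta_mx 0 i) != 0.
  apply/eqP => /(congr1 snd); exact/eqP/(@J_gen_neq0 2 0 i).
have free t : inJ (delta_mx 0 1) != t *: inJ (delta_mx 0 0).
  apply/eqP => /(congr1 snd); exact/eqP/(@J_gen_free 2 0 0 1 t isT).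
have [s [t [p [q [XX frv]]]]] := square_zero_pencil_frame symU unitU repT
  (mul0 _ _) (mul0 _ _) (mul0 _ _) (nz 0) free.
move: XX frv; set x := s *: _ + _ => XX frv.
have EE : T e *m T e = T e.
  rewrite (rep_sqr repT) (_ : jmul e e = e) //; congr pair; first exact: mul1r.
  exact: (@jmul0 (J F 2 0)).
have eJ v : jmul e (inJ v) = 0.
  congr pair; first exact: mulr0.
  by rewrite [LHS]jmulC; apply: (@jmul0 (J F 2 0)).
have ex : jmul e x = 0 by apply: jmul_comb0; apply: eJ.
have [EX XE] := peirce0 EE (rep_anticommute repT ex).
have aX y z := bform_adj y z (adjT x).
(* y E is in ker X = im X, which E kills. *)
have row0 (y : 'rV[F]_4) : y *m T e *m T e = 0.
  rewrite (frame_expand (y *m T e) frv) /= !aX -!(mulmxA y) EX mulmx0 !bform0l.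
  rewrite !scale0r !add0r mulmxDl -!scalemxAl -!mulmxA XE.
  by rewrite !mulmx0 !scaler0 addr0.
have E0 : T e = 0.
  by apply: (frame_op_eq frv) => i; rewrite -EE mulmxA row0 mulmx0.
have /(congr1 fst)/eqP : e = 0 by apply: injT; rewrite E0 linear0.
by rewrite oner_eq0.
Qed.

End Algebras.

Theorem theorem3p7 (R : realType) :
  (~ exists L : set 'M[R[i]]_4, is_embedding (J R[i] 3 1) L) /\
  (~ exists L : set 'M[R[i]]_4,
       is_embedding (prod_jordan (field_jordan R[i]) (J R[i] 2 0)) L) /\
  (forall L : set 'M[R[i]]_4, is_embedding (E1 R[i]) L ->
     congruent L (E1_4_1 R[i]) \/ congruent L (E1_4_2 R[i])) /\
  (forall L : set 'M[R[i]]_4, is_embedding (E2 R[i]) L -> congruent L (E2_4 R[i])) /\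
  (forall L : set 'M[R[i]]_4, is_embedding (E3 R[i]) L -> congruent L (E3_4 R[i])) /\
  (~ exists L : set 'M[R[i]]_4, is_embedding (E4 R[i]) L) /\
  (forall L : set 'M[R[i]]_4, is_embedding (J R[i] 3 0) L -> congruent L (F4 R[i])).
Proof.
split; first by case=> L /J3_1_not_embedded.
split; first by case=> L /C_J2_0_not_embedded.
split; first exact: E1_embeddings.
split; first exact: E2_embeddings.
split; first exact: E3_embeddings.
split; first by case=> L /E4_not_embedded.
exact: J3_0_embeddings.
Qed.
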